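(* Let $t,\ell,n$ be three integers with $t,\ell\ge 2$ and $$n\ge \left\lfloor\frac{(8t\ell+4\ell+3t-6)^2}{4\lfloor\frac{t}{2}\rfloor}\right\rfloor+8t\ell+4t+4\ell-5.$$ Then $K_{t-1}+T_{n-t+1,2}$ is the unique (up to isomorphism) extremal graph with respect to $ex(n,tC_{2\ell+1})$; that is, it is the unique $n$-vertex $tC_{2\ell+1}$-free graph with the maximum number of edges.
   Context: All graphs are finite and simple. A graph is $F$-free if it contains no (not necessarily induced) subgraph isomorphic to $F$. $ex(n,F)$ is the maximum number of edges of an $n$-vertex $F$-free graph; an $F$-free graph is extremal with respect to $ex(n,F)$ if it has $n$ vertices and $ex(n,F)$ edges. $C_k$ is the cycle of length $k$, and $tF$ is the disjoint union of $t$ copies of $F$. $K_m$ is the complete graph on $m$ vertices, $T_{m,2}$ is the complete bipartite graph on $m$ vertices whose two parts have sizes differing by at most one, and $F+H$ denotes the join of $F$ and $H$ (disjoint union plus all edges between $F$ and $H$). *)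

(* Defs.v *)
From mathcomp Require Import all_boot.

Set Implicit Arguments.
Unset Strict Implicit.
Unset Printing Implicit Defensive.

Record sgraph := SGraph {
  svertex :> finType;
  adj : rel svertex;
  adj_sym : symmetric adj;
  adj_irr : irreflexive adj }.

Arguments adj {s} : rename.

Definition edges (G : sgraph) : {set {set G}} :=
  [set [set p.1; p.2] | p : G * G & adj p.1 p.2].

Definition giso (G H : sgraph) : Prop :=
  exists2 f : G -> H, bijective f & forall x y, adj (f x) (f y) = adj x y.

(* A not necessarily induced subgraph of G isomorphic to F is the image of an
   injective, edge-preserving map; non-edges of F are unconstrained. *)
Definition contains (G F : sgraph) : bool :=
  [exists f : {ffun F -> G}, injectiveb f &&
    [forall x, forall y, adj x y ==> adj (f x) (f y)]].

Definition gfree (F G : sgraph) : bool := ~~ contains G F.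

Section EdgeSetGraph.
Variables (T : finType) (E : {set {set T}}).
Definition edgeset_rel : rel T := [rel x y | (x != y) && ([set x; y] \in E)].
Fact edgeset_sym : symmetric edgeset_rel.
Proof. by move=> x y; rewrite /edgeset_rel /= eq_sym setUC. Qed.
Fact edgeset_irr : irreflexive edgeset_rel.
Proof. by move=> x; rewrite /edgeset_rel /= eqxx. Qed.
(* Members of E that are not pairs are ignored. *)
Definition edgeset_graph := SGraph edgeset_sym edgeset_irr.
End EdgeSetGraph.

(* Every n-vertex graph is isomorphic to some [edgeset_graph E] on 'I_n, so it
   is enough to take the maximum over those (see [leq_ex] below). *)
Definition ex (n : nat) (F : sgraph) : nat :=
  \max_(E : {set {set 'I_n}} | gfree F (edgeset_graph E))
     #|edges (edgeset_graph E)|.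

Definition extremal (n : nat) (F G : sgraph) : Prop :=
  [/\ #|G| = n, gfree F G & #|edges G| = ex n F].

Section Complete.
Variable m : nat.
Definition complete_rel : rel 'I_m := [rel x y | x != y].
Fact complete_sym : symmetric complete_rel.
Proof. by move=> x y; rewrite /complete_rel /= eq_sym. Qed.
Fact complete_irr : irreflexive complete_rel.
Proof. by move=> x; rewrite /complete_rel /= eqxx. Qed.
Definition complete_graph := SGraph complete_sym complete_irr.
End Complete.

(* The cycle of length k on Z/k; only meaningful for k >= 3. The conjunct
   [x != y] matters only for k = 1. *)
Section Cycle.
Variable k : nat.
Definition cycle_rel : rel 'I_k :=
  [rel x y | (x != y) && ((y == ordS x) || (x == ordS y))].
Fact cycle_sym : symmetric cycle_rel.
Proof. by move=> x y; rewrite /cycle_rel /= eq_sym orbC. Qed.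
Fact cycle_irr : irreflexive cycle_rel.
Proof. by move=> x; rewrite /cycle_rel /= eqxx. Qed.
Definition cycle_graph := SGraph cycle_sym cycle_irr.
End Cycle.

Section Copies.
Variables (t : nat) (F : sgraph).
Definition copies_rel : rel ('I_t * F) :=
  [rel u v | (u.1 == v.1) && adj u.2 v.2].
Fact copies_sym : symmetric copies_rel.
Proof. by move=> u v; rewrite /copies_rel /= eq_sym adj_sym. Qed.
Fact copies_irr : irreflexive copies_rel.
Proof. by move=> u; rewrite /copies_rel /= adj_irr andbF. Qed.
Definition copies := SGraph copies_sym copies_irr.
End Copies.

Section Bipartite.
Variables a b : nat.
Definition bip_rel : rel ('I_a + 'I_b) :=
  fun u v => match u, v with
             | inl _, inr _ | inr _, inl _ => true
             | _, _ => false
             end.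
Fact bip_sym : symmetric bip_rel. Proof. by case=> ? []. Qed.
Fact bip_irr : irreflexive bip_rel. Proof. by case. Qed.
Definition complete_bipartite := SGraph bip_sym bip_irr.
End Bipartite.

Definition turan2 (m : nat) : sgraph := complete_bipartite m./2 (uphalf m).

Section Join.
Variables F H : sgraph.
Definition join_rel : rel (F + H) :=
  fun u v => match u, v with
             | inl x, inl y => adj x y
             | inr x, inr y => adj x y
             | _, _ => true
             end.
Fact join_sym : symmetric join_rel.
Proof. by case=> x [] y //=; rewrite adj_sym. Qed.
Fact join_irr : irreflexive join_rel.
Proof. by case=> x /=; rewrite adj_irr. Qed.
Definition join := SGraph join_sym join_irr.
End Join.

Lemma giso_edges (G H : sgraph) : giso G H -> #|edges G| = #|edges H|.
Proof.
case=> f [g fK gK] fE.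
rewrite -(card_imset (mem (edges G)) (imset_inj (can_inj fK))); congr #|pred_of_set _|.
apply/setP=> A; apply/imsetP/imsetP.
- case=> _ /imsetP[[x y]] /[!inE] /= xy -> ->.
  by exists (f x, f y); rewrite ?inE /= ?fE // imsetU !imset_set1.
- case=> -[x y] /[!inE] /= xy ->; exists [set g x; g y].
    by apply/imsetP; exists (g x, g y); rewrite // inE /= -fE !gK.
  by rewrite imsetU !imset_set1 !gK.
Qed.

Lemma giso_contains (F G H : sgraph) : giso G H -> contains G F -> contains H F.
Proof.
case=> f [g fK _] fE /existsP[h /andP[/injectiveP hI /forallP hE]].
apply/existsP; exists [ffun x => f (h x)]; apply/andP; split.
  by apply/injectiveP=> x y; rewrite !ffunE => /(can_inj fK)/hI.
by apply/forallP=> x; apply/forallP=> y; rewrite !ffunE fE (forallP (hE x)).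
Qed.

Lemma giso_sym (G H : sgraph) : giso G H -> giso H G.
Proof.
by case=> f [g fK gK] fE; exists g; [exists f | move=> x y; rewrite -fE !gK].
Qed.

Lemma giso_edgeset_graph (G : sgraph) (n : nat) :
  #|G| = n -> exists E : {set {set 'I_n}}, giso G (edgeset_graph E).
Proof.
move=> <-; pose f (x : G) := enum_rank x.
exists [set f @: (A : {set G}) | A in edges G].
exists f; first by exists enum_val; [exact: enum_rankK | exact: enum_valK].
move=> x y; rewrite /= /edgeset_rel /=.
have -> : [set f x; f y] = f @: [set x; y] by rewrite imsetU !imset_set1.
rewrite mem_imset; last first.
  exact: imset_inj enum_rank_inj.
rewrite (inj_eq enum_rank_inj); apply/andP/idP => [[nxy /imsetP[[u v]]]|xy].
  rewrite inE /= => uv /setP E.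
  have /esym xuv := E x; have /esym yuv := E y.
  move: xuv yuv nxy uv; rewrite !inE !eqxx orbT /=.
  by case/pred2P=> -> /pred2P[] ->; rewrite ?eqxx // adj_sym.
split; first by apply: contraTneq xy => ->; rewrite adj_irr.
by apply/imsetP; exists (x, y); rewrite ?inE.
Qed.

Lemma leq_ex (n : nat) (F G : sgraph) :
  #|G| = n -> gfree F G -> #|edges G| <= ex n F.
Proof.
move=> /giso_edgeset_graph[E GE] Gfree; rewrite (giso_edges GE) /ex.
apply: (bigmax_sup E) => //.
exact: contra (giso_contains (giso_sym GE)) Gfree.
Qed.

(* Main.v *)
Require Import Defs.
From mathcomp Require Import all_boot zify.

Set Implicit Arguments.
Unset Strict Implicit.
Unset Printing Implicit Defensive.

(* Let G be dense and t C_{2l+1}-free.  Deleting vertices of degree less than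
   half of the current order increases the surplus over the extremal number by
   at least t %/ 2 at each step; as the surplus of an m-vertex graph is at most
   (m - t)^2 / 4, this stops at a vertex set V with minimum degree |V| / 2 and
   |V| >= 8tl + 4t + 4l - 5.  Removing a maximal family of disjoint
   C_{2l+1} from V leaves a C_{2l+1}-free graph in which two of any three
   vertices have 2l common neighbours, and such a graph is bipartite.  The
   number of edges now forces |V| >= 12tl + 14t.  Put each removed vertex on
   the side of the bipartition where it has fewer neighbours; t disjoint edges
   inside the sides would extend greedily to t disjoint C_{2l+1}.  So the inner
   edges have no matching of size t, and as vertices of inner degree 2t extend
   any smaller matching, counting edges leaves exactly t - 1 such vertices,
   covering all inner edges.  Counting edges once more gives V = G and the
   extremal structure. *)

(** * Disjoint packings, codegrees and paths through common neighbours *)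

(** A packing that is not maximal is extended by one member. The fixed length [k] makes the
    candidates range over the finite type of [k]-tuples. The lemma serves both for odd cycles and
    for edges, taken as sequences of length 2. *)
Lemma packing_or_maximal (T : finType) (k : nat) (P : pred (seq T)) (t : nat) :
    (forall c, P c -> size c = k /\ uniq c) ->
  (exists F, [/\ size F = t, all P F & uniq (flatten F)]) \/
  (exists F, [/\ size F < t, all P F, uniq (flatten F)
              & forall c, P c -> has (mem c) (flatten F)]).
Proof.
move=> Pk; elim: t => [|t [[F [Fs FP Fu]]|[F [Fs FP Fu Fm]]]].
- by left; exists [::].
- case: (pickP (fun c : k.-tuple T => P c && ~~ has (mem c) (flatten F))).
    move=> c /andP[Pc cF]; left; exists (tval c :: F).
    rewrite /= Fs Pc FP cat_uniq cF Fu !andbT; split=> //.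
    by case/Pk: Pc.
  move=> noc; right; exists F; split=> //; first by rewrite Fs.
  move=> c Pc; have [/eqP sc _] := Pk _ Pc.
  by have := noc (Tuple sc); rewrite /= Pc /= => /negbFE.
- by right; exists F; split=> //; apply: ltnW.
Qed.

Section Graph.
Variable G : sgraph.
Implicit Types (A U V : {set G}) (x y z : G) (c p q : seq G).

Definition nbr x : {set G} := [set y | adj x y].
Definition codeg A x y := #|nbr x :&: nbr y :&: A|.
Definition is_cycle k c := [&& size c == k, uniq c & cycle adj c].

Lemma in_nbr x y : (y \in nbr x) = adj x y.
Proof. by rewrite inE. Qed.

Lemma adj_neq x y : adj x y -> x != y.
Proof. by apply: contraTneq => ->; rewrite adj_irr. Qed.

Lemma codegC A x y : codeg A x y = codeg A y x.
Proof. by rewrite /codeg (setIC (nbr x)). Qed.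

Lemma exists_setD A U : #|U| < #|A| -> exists2 x, x \in A & x \notin U.
Proof.
move=> UA; have /card_gt0P[x /setDP[]] : 0 < #|A :\: U|.
  by rewrite cardsD; have := subset_leq_card (subsetIr A U); lia.
by exists x.
Qed.

Lemma uniq_setD (n : nat) A U :
  #|U| + n <= #|A| -> exists s, [/\ size s = n, uniq s & all (mem (A :\: U)) s].
Proof.
move=> UA; exists (take n (enum (A :\: U))); split.
- rewrite size_take -cardE cardsD.
  by have := subset_leq_card (subsetIr A U); case: ltnP => //; lia.
- by rewrite take_uniq ?enum_uniq.
- by apply/allP=> x /mem_take; rewrite mem_enum.
Qed.

(** Between consecutive vertices of [x :: p] a fresh common neighbour is inserted, working from the
    end of [p]. The set [U] of forbidden vertices also collects the vertices of [p] already
    passed. *)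
Lemma linked_path A (D : nat) p x U :
    all (mem (A :\: U)) (x :: p) -> uniq (x :: p) ->
    path (fun y z => D <= codeg A y z) x p -> #|U| + (size p).*2 <= D.+1 ->
  exists q, [/\ path adj x q, last x q = last x p, size q = (size p).*2,
                uniq (x :: q) & all (mem (A :\: U)) (x :: q)].
Proof.
elim: p x U => [|y p IHp] x U xpU xpu; first by exists [::]; split.
rewrite [path _ _ _]/= => /andP[Dxy pyp] DU.
rewrite [size _]/= in DU; case/and3P: xpU => xU yU pU.
case/and3P: xpu; rewrite inE negb_or => /andP[xy xp] yp pu.
have [||||q [qpath qlast qsize qu qU]] := IHp y (x |: U).
- apply/allP=> z; rewrite inE => /predU1P[->|zp].
    by move: yU; rewrite !inE eq_sym (negPf xy).
  move/allP/(_ z zp): pU; rewrite !inE negb_or.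
  by have -> : z != x by apply: contraNneq xp => <-.
- by apply/andP.
- by [].
- by rewrite cardsU1; case: (x \in U) => /=; lia.
(* A common neighbour differs from [x] and [y] by adjacency, so only [U] and [q] count against
   [D]. *)
have [|w] := @exists_setD (nbr x :&: nbr y :&: A) (U :|: [set z in q]).
  rewrite -/(codeg A x y) cardsU cardsE (card_uniqP _); last by case/andP: qu.
  by apply: leq_trans Dxy; rewrite qsize; move: DU; clear; lia.
case/setIP=> /setIP[]; rewrite !in_nbr => xw yw wA.
rewrite in_setU negb_or => /andP[wU wq]; rewrite inE in wq.
move/allP: qU => qU; exists [:: w, y & q]; split.
- by rewrite /= xw adj_sym yw.
- by [].
- by rewrite /= qsize.
- have wx : x != w by apply: adj_neq.
  have wy : w != y by rewrite eq_sym; apply: adj_neq.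
  move: qu; rewrite cons_uniq => /andP[yq uq].
  rewrite !cons_uniq !inE !negb_or wx wy xy wq yq uq !andbT.
  by apply/negP=> xq; have := qU x; rewrite !inE xq orbT eqxx => /(_ isT).
- apply/allP=> z; rewrite !in_cons => /or3P[/eqP->|/eqP->|zq] //.
    by rewrite !inE wU wA.
  have := qU z zq.
  by rewrite !inE negb_or -andbA => /and3P[_ -> ->].
Qed.

End Graph.

(** * Graphs without C_{2l+1} of large minimum degree *)

(** A new vertex [v] is put in front of a path whose head is related to it. If neither head is, the
    two heads are related to each other: the two paths are merged by reversing one, and [v] starts a
    new path. *)
Lemma two_sorted (T : eqType) (r : rel T) (s : seq T) :
    symmetric r ->
    {in s & &, forall x y z, [|| r x y, r y z | r x z]} ->
  exists s1 s2, [/\ perm_eq (s1 ++ s2) s, sorted r s1 & sorted r s2].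
Proof.
move=> rC; elim: s => [|v s IHs] r3; first by exists [::], [::].
have [|s1 [s2 [ps s1s s2s]]] := IHs.
  by move=> x y z xs ys zs; apply: r3; rewrite inE ?xs ?ys ?zs orbT.
case: s1 s2 => [|a s1] [|b s2] in ps s1s s2s *.
- by exists [:: v], [::]; split=> //; rewrite /= perm_cons.
- by exists [:: v], (b :: s2); split=> //; rewrite /= perm_cons.
- exists (a :: s1), [:: v]; split=> //.
  by rewrite perm_catC /= perm_cons -[a :: s1]cats0.
have as_ : a \in v :: s by rewrite inE -(perm_mem ps) mem_head orbT.
have bs : b \in v :: s by rewrite inE -(perm_mem ps) mem_cat mem_head !orbT.
case/or3P: (r3 a v b as_ (mem_head v s) bs) => [av|vb|ab].
- exists (v :: a :: s1), (b :: s2); split=> //; first by rewrite /= perm_cons.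
  by rewrite /= rC av.
- exists (a :: s1), (v :: b :: s2); split=> //; last by rewrite /= vb.
  by rewrite perm_catC cat_cons perm_cons perm_catC.
- exists (rev (a :: s1) ++ b :: s2), [:: v]; split=> //.
    rewrite perm_catC /= perm_cons; apply: perm_trans ps.
    by rewrite perm_cat2r perm_rev.
  have : sorted r (rcons (rev s1) a).
    by rewrite -rev_cons rev_sorted; under eq_sorted do rewrite rC.
  rewrite rev_cons; case: (rev s1) => [|c q] /=; first by rewrite ab.
  by rewrite rcons_path cat_path last_rcons /= rcons_path ab => ->.
Qed.

(** Inclusion-exclusion with the triple intersection dropped. *)
Lemma leq_card3 (T : finType) (A B C : {set T}) :
  #|A| + #|B| + #|C|
    <= #|A :|: B :|: C| + #|A :&: B| + #|B :&: C| + #|A :&: C|.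
Proof.
have := cardsUI (A :|: B) C; have := cardsUI A B.
have := cardsUI (A :&: C) (B :&: C); rewrite -setIUl; lia.
Qed.

Section Bipartite.
Variables (G : sgraph) (A : {set G}) (l : nat).
Hypothesis l2 : 2 <= l.
Hypothesis degA : {in A, forall x, #|A| + 6 * l <= 3 * #|nbr x :&: A| + 2}.
Hypothesis free : forall c, is_cycle (2 * l + 1) c -> ~~ all (mem A) c.
Implicit Types (x y z : G) (p q : seq G).

Let R x y := 2 * l <= codeg A x y.

Let RC : symmetric R. Proof. by move=> x y; rewrite /R codegC. Qed.

(** By [degA] three degrees in [A] sum to at least |A| + 6l - 2, so the three codegrees sum to at
    least 6l - 2, more than three times 2l - 1. Repeated vertices are allowed, so [R] is also
    reflexive on [A]. *)
Lemma linked_triple : {in A & &, forall x y z, [|| R x y, R y z | R x z]}.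
Proof.
move=> x y z xA yA zA; rewrite /R.
have := leq_card3 (nbr x :&: A) (nbr y :&: A) (nbr z :&: A).
rewrite -!setIUl -!setIIl -/(codeg A x y) -/(codeg A y z) -/(codeg A x z).
have := subset_leq_card (subsetIr (nbr x :|: nbr y :|: nbr z) A).
have := degA xA; have := degA yA; have := degA zA.
lia.
Qed.

(* Adjacent [x] and [y] with [2 * l] common neighbours would have an [R]-path
   of [l] vertices among these, closing up to a cycle through [x] and [y]. *)
Lemma adj_not_linked : {in A &, forall x y, adj x y -> ~~ R x y}.
Proof.
move=> x y xA yA xy; apply/negP=> Rxy.
set W := nbr x :&: nbr y :&: A.
have WA w : w \in W -> [&& adj x w, adj y w & w \in A].
  by rewrite !inE -andbA.
have [u v w|s1 [s2 [ps s1R s2R]]] := @two_sorted _ R (enum W) RC.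
  by rewrite !mem_enum => /WA/and3P[_ _ ?] /WA/and3P[_ _ ?] /WA/and3P[_ _ ?];
    apply: linked_triple.
have su : uniq (s1 ++ s2) by rewrite (perm_uniq ps) enum_uniq.
have sz : 2 * l <= size s1 + size s2.
  by rewrite -size_cat (perm_size ps) -cardE.
(* The two paths cover at least 2l vertices, so one of them has at least l. *)
have [s [sl sR {}su sW]] :
    exists s, [/\ l <= size s, sorted R s, uniq s & {subset s <= W}].
  have sW : {subset s1 ++ s2 <= W} by move=> w; rewrite (perm_mem ps) mem_enum.
  move: su; rewrite cat_uniq => /and3P[u1 _ u2].
  case: (leqP l (size s1)) => ls; [exists s1 | exists s2]; split=> //.
  - by move=> w ws; apply: sW; rewrite mem_cat ws.
  - by move: sz ls; move: (size s1) (size s2) => a b; lia.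
  - by move=> w ws; apply: sW; rewrite mem_cat ws orbT.
have : sorted R (take l s) by apply: take_sorted.
have : uniq (take l s) by apply: take_uniq.
have : {subset take l s <= W} by move=> w /mem_take/sW.
have : size (take l s) = l by rewrite size_take; case: ltnP; lia.
case: (take l s) => [|w p] /= wpl wpW wpu wpR; first by lia.
have lastW : last w p \in W by apply: wpW; apply: mem_last.
have [||q [qpath qlast qsize qu qA]] :=
    @linked_path G A (2 * l) p w [set x; y] _ wpu wpR.
- apply/allP=> v /wpW/WA/and3P[xv yv vA]; rewrite /= !inE vA andbT negb_or.
  by rewrite ![v == _]eq_sym !adj_neq.
- by rewrite cards2; move: wpl; clear; case: (_ != _) => /=; lia.
move/allP: qA => qA; apply: (negP (free (c := [:: y, x, w & q]) _)); last first.
  by apply/allP=> v; rewrite 2!in_cons => /or3P[/eqP->|/eqP->|/qA/setDP[]].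
have := WA w (wpW w (mem_head _ _)); case/and3P=> xw yw _.
have /and3P[_ ylast _] := WA _ lastW.
apply/and3P; split; first by rewrite /= qsize; move: wpl; clear; lia.
  rewrite 2!cons_uniq qu andbT in_cons negb_or [y == x]eq_sym adj_neq //=.
  have qU v : v \in w :: q -> (v != x) && (v != y).
    by move/qA/setDP=> [_]; rewrite !inE negb_or.
  by apply/andP; split; apply/negP=> /qU; rewrite eqxx ?andbF.
by rewrite /= rcons_path qlast qpath [adj y x]adj_sym xy xw [adj _ y]adj_sym ylast.
Qed.

(** [y] is linked to neither of its neighbours, so the triple property links these to each other:
    every neighbourhood is a clique for [R]. *)
Lemma linked_via x y z :
  x \in A -> y \in A -> z \in A -> adj y x -> adj y z -> R x z.
Proof.
move=> xA yA zA yx yz; have := linked_triple xA yA zA.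
by rewrite RC (negPf (adj_not_linked yA xA yx)) (negPf (adj_not_linked yA zA yz)).
Qed.

(* Otherwise [x - a - y - b - z] and a common neighbour of [a] and [z] give a
   C_5, and the chain [a, z, y] can be lengthened inside the neighbourhood of
   [b], which is a clique for [R]; its vertices are then joined through common
   neighbours into a path of length [2 * l] from [a] to its neighbour [y]. *)
Lemma linked_trans x y z :
  x \in A -> y \in A -> z \in A -> R x y -> R y z -> R x z.
Proof.
move=> xA yA zA Rxy Ryz; apply: contraT => nRxz.
have common u v : R u v -> exists a, [&& adj u a, adj v a & a \in A].
  move=> Ruv; have /card_gt0P[a] : 0 < codeg A u v by apply: leq_trans Ruv; lia.
  by rewrite !inE -andbA; exists a.
have [a /and3P[xa ya aA]] := common _ _ Rxy.
have [b /and3P[yb zb bA]] := common _ _ Ryz.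
have Raz : R a z.
  have := linked_triple xA aA zA.
  by rewrite (negPf nRxz) (negPf (adj_not_linked xA aA xa)) orbF.
(* [a] and [b] are neighbours of [y], hence linked, hence not adjacent. This keeps [a] out of the
   neighbourhood of [b], from which [w] is chosen. *)
have nab : ~~ adj a b.
  by apply/negP=> /(adj_not_linked aA bA); rewrite (linked_via aA yA bA).
have az : a != z.
  by apply: contraTneq Ryz => <-; apply: adj_not_linked.
have zy : z != y.
  by apply: contraTneq Raz => ->; rewrite RC; apply: adj_not_linked.
have ay : a != y by rewrite eq_sym adj_neq.
(* With [z] in front and [y] at the end, l - 2 vertices make an [R]-path of l steps from [a], which
   doubles to 2l + 1 vertices. *)
have [|w [ws wu wA]] := @uniq_setD G (l - 2) (nbr b :&: A) [set z; y].
  have := degA bA; have := subset_leq_card (subsetIr (nbr b) A).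
  by rewrite cards2; move: l2; clear; case: (_ != _) => /=; lia.
have wb v : v \in w -> [&& v != z, v != y, adj b v & v \in A].
  by move/(allP wA); rewrite /= !inE negb_or -!andbA.
have clique : {in rcons w y, forall u, R z u}.
  move=> u; rewrite mem_rcons inE => /predU1P[->|/wb/and4P[_ _ bu uA]].
    by rewrite RC.
  by apply: (linked_via zA bA uA); rewrite // adj_sym.
have Rpath : path R a (z :: rcons w y).
  rewrite /= Raz; case: w ws wu wA wb clique => [|v w] _ _ _ wb clique.
    by rewrite /= RC Ryz.
  rewrite /= -[rcons _ _]/(rcons _ _) clique ?mem_head //=.
  have Rb u1 u2 : u1 \in v :: rcons w y -> u2 \in v :: rcons w y -> R u1 u2.
    have bu u : u \in v :: rcons w y -> adj b u && (u \in A).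
      rewrite -rcons_cons mem_rcons inE => /predU1P[->|/wb/and4P[_ _ -> -> //]].
      by rewrite adj_sym yb.
    move=> /bu/andP[bu1 u1A] /bu/andP[bu2 u2A].
    exact: (linked_via u1A bA u2A).
  elim: (rcons w y) v Rb {wb clique} => //= u s IHs v Rb.
  rewrite Rb ?mem_head ?inE ?eqxx ?orbT //=; apply: IHs => u1 u2 u1s u2s.
  by apply: Rb; rewrite inE ?u1s ?u2s orbT.
have [|||q [qpath qlast qsize qu qA]] :=
    @linked_path G A (2 * l) (z :: rcons w y) a set0 _ _ Rpath.
- rewrite setD0 [all _ _]/= aA zA all_rcons /= yA /=.
  by apply/allP=> v /wb/and4P[].
- rewrite [uniq _]/= rcons_uniq wu !inE !mem_rcons !inE.
  rewrite (negPf az) (negPf ay) (negPf zy).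
  rewrite !andbT /=; apply/and3P; split.
  + by apply/negP=> /wb/and4P[_ _]; rewrite adj_sym (negPf nab).
  + by apply/negP=> /wb/and4P[]; rewrite eqxx.
  + by apply/negP=> /wb/and4P[]; rewrite eqxx.
- by rewrite cards0 /= size_rcons ws; move: l2; clear; lia.
suff cq : is_cycle (2 * l + 1) (a :: q).
  by case/negP: (free cq); apply/allP=> v /(allP qA)/setDP[].
apply/and3P; split=> //.
  by rewrite /= qsize /= size_rcons ws; move: l2; clear; lia.
by rewrite /= rcons_path qpath qlast /= last_rcons.
Qed.

(** On [A] the relation [R] is an equivalence with at most two classes, since of any three vertices
    two are linked. Adjacent vertices are never linked, so the classes are the two sides. *)
Lemma bipartition :
  exists X Y : {set G}, [/\ X :|: Y = A, [disjoint X & Y],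
    {in X &, forall x y, ~~ adj x y} & {in Y &, forall x y, ~~ adj x y}].
Proof.
case: (set_0Vmem A) => [->|[x0 x0A]].
  exists set0, set0; rewrite setU0; split=> //; last 2 first.
  - by move=> x y; rewrite inE.
  - by move=> x y; rewrite inE.
  by rewrite -setI_eq0 setI0.
exists (A :&: [set x | R x0 x]), (A :\: [set x | R x0 x]); split.
- exact: setID.
- rewrite -setI_eq0; apply/eqP/setP=> x; rewrite !inE.
  by case: (R x0 x); rewrite ?andbF.
- move=> x y; rewrite !inE => /andP[xA Rx] /andP[yA Ry].
  apply: contraTN (@linked_trans x x0 y xA x0A yA _ Ry); last by rewrite RC.
  exact: adj_not_linked.
- move=> x y; rewrite !inE => /andP[nRx xA] /andP[nRy yA].
  have := linked_triple x0A xA yA; rewrite (negPf nRx) (negPf nRy) orbF /=.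
  by apply: contraTN; apply: adj_not_linked.
Qed.

End Bipartite.

(** * Greedy constructions of cycles and matchings *)

Section Greedy.
Variable G : sgraph.
Implicit Types (A P U V K : {set G}) (x y z : G) (c s : seq G) (M F : seq (seq G)).

(** Neighbours [u] of [x] and [v] of [y] in [P], with l - 2 further vertices of [P] between them,
    give l - 1 linked steps and so a path on 2l - 1 vertices outside [U]. The edge [x y] closes
    it. *)
Lemma cycle_through_edge A P U (D l : nat) x y :
    2 <= l -> P \subset A -> {in P &, forall u v, D <= codeg A u v} ->
    adj x y -> x \in U -> y \in U -> #|U| + 2 * l <= D ->
    D <= #|nbr x :&: P| -> D <= #|nbr y :&: P| ->
  exists2 c, is_cycle (2 * l + 1) c & {subset c <= [set x; y] :|: (A :\: U)}.
Proof.
move=> l2 PA DP xy xU yU UD Dx Dy.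
have [|u] := @exists_setD G (nbr x :&: P) U; first by move: l2 UD Dx; clear; lia.
case/setIP=> xu uP uU; rewrite in_nbr in xu.
have [|v] := @exists_setD G (nbr y :&: P) (u |: U).
  by rewrite cardsU1 uU; move: l2 UD Dy; clear; lia.
case/setIP=> yv vP; rewrite in_nbr in yv.
rewrite in_setU1 negb_or => /andP[vu vU].
have [|s [ss su sP]] := @uniq_setD G (l - 2) P (v |: (u |: U)).
  have := subset_leq_card (subsetIr (nbr x) P).
  rewrite !cardsU1 !inE negb_or vu vU uU /=; move: l2 UD Dx; clear; lia.
move/allP: sP => sP.
have sPU z : z \in rcons s v -> [&& z != u, z \in P & z \notin U].
  rewrite mem_rcons inE => /predU1P[->|/sP]; first by rewrite vu vP.
  by rewrite !inE !negb_or -!andbA => /and4P[_ -> -> ->].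
have linked : path (fun z w => D <= codeg A z w) u (rcons s v).
  have {}sPU : {subset u :: rcons s v <= P}.
    by move=> z; rewrite inE => /predU1P[->|/sPU/and3P[]].
  elim: (rcons s v) u sPU {xu uP uU vu sP} => //= w r IHr u uP.
  rewrite DP ?uP ?mem_head ?inE ?eqxx ?orbT //=; apply: IHr => z zr.
  by apply: uP; rewrite inE zr orbT.
have [|||q [qpath qlast qsize qu qA]] := @linked_path G A D (rcons s v) u U _ _ linked.
- apply/allP=> z; rewrite inE => /predU1P[->|/sPU/and3P[_ zP zU]].
    by rewrite !inE uU (subsetP PA).
  by rewrite !inE zU (subsetP PA).
- rewrite cons_uniq rcons_uniq su andbT; apply/andP; split.
    by apply/negP=> /sPU; rewrite eqxx.
  by apply/negP=> /sP; rewrite !inE eqxx.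
- by rewrite size_rcons ss; move: l2 UD; clear; lia.
move/allP: qA => qA; exists [:: y, x, u & q].
  apply/and3P; split; first by rewrite /= qsize size_rcons ss; move: l2; clear; lia.
    rewrite 2!cons_uniq qu andbT in_cons negb_or [y == x]eq_sym adj_neq //=.
    by apply/andP; split; apply/negP=> /qA; rewrite !inE ?xU ?yU.
  rewrite /= rcons_path qpath qlast last_rcons xu [adj y x]adj_sym xy.
  by rewrite [adj v y]adj_sym yv.
move=> z; rewrite 2!in_cons => /or3P[/eqP->|/eqP->|/qA zA].
- by rewrite !inE eqxx orbT.
- by rewrite !inE eqxx.
- by rewrite in_setU; apply/orP; right.
Qed.

(** Edges are sequences of length 2, so that [packing_or_maximal] applies; on [[:: x; y]] the
    condition [cycle I] means [I x y] and [I y x]. *)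
Definition matching (I : rel G) V M :=
  all (fun s => [&& size s == 2, uniq s, all (mem V) s & cycle I s]) M
  && uniq (flatten M).

(** Greedy: the edges are extended to cycles one by one. [U] holds all matched vertices and the
    cycles already built, so each step enlarges it by at most 2l + 1 vertices. *)
Lemma matching_packing A (I : rel G) V (D l : nat) M U :
    (forall x y (W : {set G}), I x y -> x \in W -> y \in W -> #|W| + 2 * l <= D ->
       exists2 c, is_cycle (2 * l + 1) c
                & {subset c <= [set x; y] :|: (A :\: W)}) ->
    matching I V M -> {subset flatten M <= U} ->
    #|U| + size M * (2 * l + 1) <= D ->
  exists F, [/\ size F = size M, all (is_cycle (2 * l + 1)) F, uniq (flatten F)
    & {subset flatten F <= [set x in flatten M] :|: (A :\: U)}].
Proof.
move=> cycI; elim: M U => [|s M IHM] U; first by exists [::].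
rewrite /matching /= => /andP[/andP[/and4P[ss _ _]]].
case: s ss => [|x [|y []]] //= _ /and3P[xy _ _] MI.
rewrite -[_ && _]/(uniq ([:: x; y] ++ flatten M)) cat_uniq.
case/and3P=> _ /hasPn dM Mu MU UD.
have xU : x \in U by apply: MU; rewrite !inE eqxx.
have yU : y \in U by apply: MU; rewrite !inE eqxx orbT.
have [|c cC cU] := cycI x y U xy xU yU.
  by move: UD; clear; lia.
have /and3P[/eqP cs cu _] := cC.
have [|||F [Fs FC Fu FU]] := IHM (U :|: [set z in c]).
- by rewrite /matching MI.
- by move=> z zM; rewrite inE MU // !inE zM !orbT.
- rewrite cardsU cardsE (card_uniqP cu) cs; move: UD; clear; lia.
exists (c :: F); rewrite /= Fs cC FC cat_uniq cu Fu; split=> //.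
  rewrite andbT; apply/hasPn=> z /FU; rewrite !inE negb_or -andbA.
  move=> /orP[zM|/and3P[_ zc _]] //.
  apply/negP=> /cU; rewrite !inE MU ?inE ?zM ?orbT //= orbF.
  by have := dM z zM; rewrite /= !inE => /negPf->.
move=> z; rewrite mem_cat => /orP[/cU|/FU]; rewrite !inE -!orbA.
  by case/or3P=> [->|->|->]; rewrite ?orbT.
rewrite negb_or -andbA => /orP[->|/and3P[-> _ ->]]; by rewrite ?orbT.
Qed.

(** The vertices of [s] receive new partners one by one. A partner has to avoid [s] and the 2 size M
    matched vertices, fewer than the assumed degree. The sum size M + size s is constant along the
    recursion, so the degree bound persists. *)
Lemma star_matching (I : rel G) V M s :
    symmetric I -> irreflexive I -> uniq s -> all (mem V) s ->
    ~~ has (mem (flatten M)) s -> matching I V M ->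
    {in s, forall x, 2 * (size M + size s) <= #|[set y in V | I x y]|} ->
  exists2 M', matching I V M' & size M' = size M + size s.
Proof.
move=> IC Iirr; elim: s M => [|x s IHs] M; first by exists M; rewrite ?addn0.
rewrite /= negb_or => /andP[xs su] /andP[xV sV] /andP[xM sM] MI deg.
have [|y] := @exists_setD G [set y in V | I x y] [set y in x :: s ++ flatten M].
  apply: leq_trans (deg x (mem_head _ _)); rewrite /= cardsE.
  have Ms : size (flatten M) = 2 * size M.
    case/andP: MI => + _; elim: (M) => //= e M' IHM' /andP[/and4P[/eqP es _ _ _]].
    by rewrite size_cat es => /IHM' ->; clear; lia.
  by apply: leq_ltn_trans (card_size _) _; rewrite /= size_cat Ms; clear; lia.
rewrite !inE mem_cat !negb_or => /andP[yV xy] /and3P[yx ys yM].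
case/andP: MI => MI Mu.
have [|||||M' M'I M's] := IHs ([:: x; y] :: M).
- by [].
- by [].
- apply/hasPn=> z zs; rewrite /= !inE !negb_or.
  rewrite (hasPn sM) // andbT; apply/andP; split.
    by apply: contraNneq xs => <-.
  by apply: contraNneq ys => <-.
- rewrite /matching /= MI xV yV xy IC xy Mu !inE yM (eq_sym x y) yx /=.
  by rewrite (negPf yx) /= xM.
- move=> z zs; have := deg z; rewrite inE zs orbT => /(_ isT) /=; clear; lia.
by exists M'; rewrite // M's /=; clear; lia.
Qed.

End Greedy.

(** * The extremal graph *)

Lemma handshake (G : sgraph) : 2 * #|edges G| = \sum_(x : G) #|nbr x|.
Proof.
pose P := [set p : G * G | adj p.1 p.2].
have -> : \sum_(x : G) #|nbr x| = \sum_(p in P) 1.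
  under eq_bigr do rewrite -sum1_card.
  by rewrite pair_big_dep; apply: eq_bigl => -[x y]; rewrite !inE.
have -> : edges G = [set [set p.1; p.2] | p in P].
  by apply/setP=> E; apply/imsetP/imsetP=> -[p]; rewrite inE => pP ->;
    exists p; rewrite ?inE.
(* Ordered adjacent pairs are grouped by the edge they span; each group has two members. *)
rewrite (partition_big_imset (fun p : G * G => [set p.1; p.2])) /=.
rewrite mulnC -sum_nat_const; apply: eq_bigr => _ /imsetP[[x y] /[!inE] /= xy ->].
have <- : #|[set (x, y); (y, x)]| = 2.
  by rewrite cards2 xpair_eqE negb_and adj_neq.
rewrite -sum1_card; apply: eq_bigl => -[u v]; rewrite !inE /= !xpair_eqE.
apply/orP/andP=> [[]/andP[/eqP-> /eqP->]|[uv /eqP/setP E]].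
- by rewrite xy.
- by rewrite adj_sym xy setUC.
have := E u; have := E v; rewrite !inE !eqxx orbT /=.
move=> /esym/pred2P[] eu /esym/pred2P[] ev;
  by move: uv; rewrite eu ev ?adj_irr ?eqxx; auto.
Qed.

Lemma flatten_uniq_nth (T : eqType) (F : seq (seq T)) (i j : nat) (x : T) :
  uniq (flatten F) -> x \in nth [::] F i -> x \in nth [::] F j -> i = j.
Proof.
have nthF (E : seq (seq T)) k : x \in nth [::] E k -> x \in flatten E.
  move=> xE; apply/flattenP; exists (nth [::] E k) => //; apply: mem_nth.
  by case: ltnP xE => // Ek; rewrite nth_default.
elim: F i j => [|s F IHF] [|i] [|j] //=; rewrite cat_uniq => /and3P[_ /hasPn sF uF].
- by move=> xs /nthF/sF/negP.
- by move=> /nthF/sF/negP.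
- by move=> xi xj; rewrite (IHF i j).
Qed.

Lemma cycle_nth (T : eqType) (e : rel T) (x0 : T) (c : seq T) (i : nat) :
  cycle e c -> i < size c -> e (nth x0 c i) (nth x0 c (i.+1 %% size c)).
Proof.
case: c => // x p /(pathP x0) ep ip; move: (ep i); rewrite size_rcons => /(_ ip).
rewrite -rcons_cons nth_rcons ip nth_rcons /=.
move: ip; rewrite ltnS leq_eqVlt => /predU1P[->|ip].
  by rewrite ltnn eqxx modnn.
by rewrite ip modn_small.
Qed.

Lemma packing_contains (G : sgraph) (x0 : G) (t k : nat) (F : seq (seq G)) :
    size F = t -> all (is_cycle k) F -> uniq (flatten F) ->
  contains G (copies t (cycle_graph k)).
Proof.
move=> Ft FC Fu.
have FCi (i : 'I_t) : is_cycle k (nth [::] F i).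
  by apply: (allP FC); rewrite mem_nth ?Ft.
have Fk (i : 'I_t) : size (nth [::] F i) = k by case/and3P: (FCi i) => /eqP.
apply/existsP.
exists [ffun u : copies t (cycle_graph k) => nth x0 (nth [::] F u.1) u.2].
apply/andP; split.
  apply/injectiveP=> -[i j] [i' j']; rewrite !ffunE /= => E.
  have mem_i : nth x0 (nth [::] F i) j \in nth [::] F i by rewrite mem_nth ?Fk.
  have ii' : i = i'.
    apply/val_inj/(flatten_uniq_nth Fu mem_i).
    by rewrite E mem_nth ?Fk.
  move: E; rewrite -ii' => /eqP; rewrite nth_uniq ?Fk //; last by case/and3P: (FCi i).
  by move=> /eqP/val_inj->.
apply/forallP=> -[i j]; apply/forallP=> -[i' j']; rewrite !ffunE /=.
apply/implyP=> /andP[/eqP/= <- /andP[_ ]].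
have step (j1 : 'I_k) :
    adj (nth x0 (nth [::] F i) j1) (nth x0 (nth [::] F i) (ordS j1)).
  have /and3P[_ _ /cycle_nth Fadj] := FCi i.
  by have := Fadj x0 j1; rewrite Fk; apply.
by case/orP=> /eqP->; rewrite // adj_sym.
Qed.

(** An alternating colouring follows the parity of the position, so positions 0 and 2l, which are
    consecutive on the cycle, agree. *)
Lemma odd_cycle_not_alternating (l : nat) (c : 'I_(2 * l).+1 -> bool) :
  exists j, c (ordS j) = c j.
Proof.
have [j|alt] := pickP (fun j => c (ordS j) == c j); first by move/eqP; exists j.
have par j : j <= 2 * l -> c (inord j) = odd j (+) c ord0.
  elim: j => [|j IHj] jl; first by congr c; apply: val_inj; rewrite /= inordK.
  have jS : inord j.+1 = ordS (inord j : 'I_(2 * l).+1).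
    by apply: val_inj; rewrite /= !inordK ?modn_small //; lia.
  have := alt (inord j); rewrite -jS IHj; last by lia.
  by rewrite /=; case: (c _); case: (odd j); case: (c ord0).
have := alt (inord (2 * l)); rewrite par // oddM /=.
have -> : ordS (inord (2 * l)) = ord0 :> 'I_(2 * l).+1.
  by apply: val_inj; rewrite /= inordK // modnn.
by rewrite eqxx.
Qed.

(** Each odd cycle must use a vertex of the complete graph, and disjoint cycles use different ones;
    there are only a < t of them. *)
Lemma join_bipartite_free (a b c t l : nat) :
    0 < l -> a < t ->
  gfree (copies t (cycle_graph (2 * l + 1)))
        (join (complete_graph a) (complete_bipartite b c)).
Proof.
rewrite addn1 => l0 at_; apply/negP=> /existsP[f /andP[/injectiveP finj /forallP fE]].
have hit (i : 'I_t) : exists x : 'I_a, exists j, f (i, j) = inl x.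
  (* Vertices of the complete graph get the colour of the right side. Two consecutive vertices of
     equal colour are adjacent, so one of them lies in the complete graph. *)
  pose col j := if f (i, j) is inr (inl _) then true else false.
  have [j colj] := odd_cycle_not_alternating col.
  have jS : j != ordS j.
    apply/eqP=> /(congr1 val) /=; have := ltn_ord j; rewrite ltnS leq_eqVlt.
    move=> /predU1P[->|jl]; first by rewrite modnn; lia.
    by rewrite modn_small //; lia.
  have : adj (f (i, j)) (f (i, ordS j)).
    apply: (implyP (forallP (fE (i, j)) (i, ordS j))).
    by apply/andP; split=> //; apply/andP; split=> //; rewrite eqxx.
  move: colj; rewrite /col.
  case fj: (f (i, j)) => [x|[x|x]]; first by exists x, j.
    by case fSj: (f (i, ordS j)) => [y|[y|y]] // _ _; exists y, (ordS j).
  by case fSj: (f (i, ordS j)) => [y|[y|y]] // _ _; exists y, (ordS j).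
have [g gE] := fin_all_exists hit.
have ginj : injective g.
  by move=> i i' E; have [j fj] := gE i; have [j' fj'] := gE i';
    have /finj[] : f (i, j) = f (i', j') by rewrite fj fj' E.
by have := leq_card g ginj; rewrite !card_ord leqNgt at_.
Qed.

Lemma join_bipartite_edges (a b c : nat) :
  2 * #|edges (join (complete_graph a) (complete_bipartite b c))|
    = a * a.-1 + 2 * a * (b + c) + 2 * (b * c).
Proof.
set J := join _ _.
have deg (u : J) : #|nbr u| = \sum_(i < a) (adj u (inl i : J) : nat)
    + (\sum_(i < b) (adj u (inr (inl i) : J) : nat)
       + \sum_(i < c) (adj u (inr (inr i) : J) : nat)).
  rewrite -sum1_card big_mkcond /= big_sumType /= big_sumType /=.
  by congr (_ + (_ + _)); apply: eq_bigr => i _; rewrite inE.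
rewrite handshake big_sumType /= big_sumType /=; under eq_bigr do rewrite deg.
under [X in _ + (X + _)]eq_bigr do rewrite deg.
under [X in _ + (_ + X)]eq_bigr do rewrite deg.
rewrite /= !sum_nat_const !card_ord ?muln0 ?muln1.
have -> : \sum_(i < a) (\sum_(j < a) (i != j) + (b + c)) = a * (a.-1 + (b + c)).
  rewrite -[a in RHS]card_ord -sum_nat_const; apply: eq_bigr => i _.
  congr (_ + _); rewrite -(@cardC1 'I_a i) -sum1_card [RHS]big_mkcond.
  by apply: eq_bigr => j _; rewrite inE eq_sym; case: eqP.
lia.
Qed.

(** The cardinality condition stands for disjointness: the enumeration map from the join onto [G] is
    surjective between types of equal size, hence bijective. *)
Lemma join_bipartite_giso (G : sgraph) (K X Y : {set G}) :
    K :|: X :|: Y = setT -> #|K| + #|X| + #|Y| = #|G| ->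
    {in K, forall x y, adj x y = (x != y)} ->
    {in X &, forall x y, ~~ adj x y} -> {in Y &, forall x y, ~~ adj x y} ->
    {in X & Y, forall x y, adj x y} ->
  giso G (join (complete_graph #|K|) (complete_bipartite #|X| #|Y|)).
Proof.
move=> cov card adjK adjX adjY adjXY.
pose f (u : 'I_#|K| + ('I_#|X| + 'I_#|Y|)) : G := match u with
  | inl i => enum_val i | inr (inl i) => enum_val i | inr (inr i) => enum_val i end.
have fsurj x : exists u, f u = x.
  have := in_setT x; rewrite -cov !inE -orbA => /or3P[] xA.
  - by exists (inl (enum_rank_in xA x)); rewrite /= enum_rankK_in.
  - by exists (inr (inl (enum_rank_in xA x))); rewrite /= enum_rankK_in.
  - by exists (inr (inr (enum_rank_in xA x))); rewrite /= enum_rankK_in.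
have [g fK] := fin_all_exists fsurj.
have [h gK hK] : bijective g.
  apply: inj_card_bij (can_inj fK) _.
  by rewrite !card_sum !card_ord addnA card.
have finj : injective f by apply: (can_inj (g := g)) => u; rewrite -[u]hK fK.
exists g; first by exists h.
suff fadj u v : adj (f u) (f v)
    = adj (u : join (complete_graph #|K|) (complete_bipartite #|X| #|Y|)) v.
  by move=> x y; rewrite -fadj !fK.
case: u => [i|u].
  rewrite adjK ?enum_valP // (inj_eq finj).
  by case: v => [j|v] //=.
case: v => [j|v]; first by rewrite adj_sym adjK ?enum_valP // (inj_eq finj).
case: u v => i [] j.
- by rewrite (negPf (adjX _ _ (enum_valP i) (enum_valP j))).
- by rewrite adjXY ?enum_valP.
- by rewrite adj_sym adjXY ?enum_valP.
- by rewrite (negPf (adjY _ _ (enum_valP i) (enum_valP j))).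
Qed.

(** * Passing to a subset of large minimum degree *)

(** Twice the number of edges induced on [V], with no induced graph to build. *)
Definition esum (G : sgraph) (V : {set G}) := \sum_(x in V) #|nbr x :&: V|.

(* Twice the number of edges of [join (complete_graph r) (turan2 (m - r))]. *)
Definition ext2 (r m : nat) :=
  r * r.-1 + 2 * r * (m - r) + 2 * ((m - r)./2 * uphalf (m - r)).

Lemma half_uphalf_sqr p : 4 * (p./2 * uphalf p) + odd p = p * p.
Proof.
have := odd_double_half p; rewrite uphalf_half -muln2.
by case: (odd p) p./2 => h <- /=; clear; nia.
Qed.

(** A vertex added to the smaller side of the Turan part has degree r + ceil((m - r) / 2). *)
Lemma ext2S r m : r <= m -> ext2 r m.+1 = ext2 r m + 2 * (m + r.+1)./2.
Proof.
move=> rm; rewrite /ext2 subSn //; set p := m - r.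
have -> : (m + r.+1)./2 = r + uphalf p.
  have -> : m + r.+1 = p.+1 + r.*2 by rewrite /p; move: rm; clear; lia.
  by rewrite halfD odd_double andbF add0n doubleK addnC.
rewrite [uphalf p.+1]uphalf_half [p.+1./2]uphalf_half uphalf_half /=.
have := odd_double_half p; rewrite -muln2.
by case: (odd p) p./2 => h <- /=; clear; nia.
Qed.

Section EdgeSums.
Variable G : sgraph.
Implicit Types (V : {set G}) (x : G).

Lemma esum_setD1 V x : x \in V -> esum V = esum (V :\ x) + 2 * #|nbr x :&: V|.
Proof.
move=> xV; rewrite /esum (big_setD1 x) //=.
have degD y : #|nbr y :&: V| = #|nbr y :&: (V :\ x)| + adj x y.
  rewrite (cardsD1 x (nbr y :&: V)) inE in_nbr xV andbT adj_sym addnC.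
  by congr (_ + _); apply: eq_card => z; rewrite !inE andbCA.
under [X in _ + X]eq_bigr do rewrite degD.
have cardN : \sum_(y in V :\ x) (adj x y : nat) = #|nbr x :&: V|.
  rewrite -sum1_card big_mkcond [RHS]big_mkcond; apply: eq_bigr => y _.
  rewrite !inE; case: eqP => [->|_]; rewrite ?adj_irr //=.
  by case: (y \in V); case: adj.
by rewrite big_split /= cardN mul2n -addnn addnCA.
Qed.

Lemma leq_esum V : esum V <= #|V| * #|V|.-1.
Proof.
rewrite -sum_nat_const; apply: leq_sum => x xV.
rewrite (cardsD1 x V) xV /=; apply/subset_leq_card/subsetP=> y.
by rewrite !inE => /andP[/adj_neq xy ->]; rewrite eq_sym xy.
Qed.

(** Going from m + 1 to m vertices, a deleted vertex has degree d <= m / 2, while [ext2] drops by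
    twice floor((m + t) / 2). Hence the surplus of [esum] over [ext2] grows by at least 2 (t %/ 2),
    which is the last condition on [V]. *)
Lemma dense_subset (t l n : nat) :
    2 <= t -> 2 <= l ->
    (8 * t * l + 4 * l + 3 * t - 6) ^ 2 %/ (4 * (t %/ 2))
      + 8 * t * l + 4 * t + 4 * l - 5 <= n ->
    #|G| = n -> ext2 (t - 1) n <= esum [set: G] ->
  exists V : {set G}, [/\ 8 * t * l + 4 * t + 4 * l <= #|V| + 5,
    {in V, forall x, #|V| <= 2 * #|nbr x :&: V|}
    & ext2 (t - 1) #|V| + 2 * (t %/ 2) * (n - #|V|) <= esum V].
Proof.
move=> t2 l2 hn Gn Gsum.
(* The required bound on the order of [V] says [M < #|V|]. *)
have [M ME] : exists M, 8 * t * l + 4 * t + 4 * l = M + 6.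
  by exists (8 * t * l + 4 * t + 4 * l - 6); move: t2 l2; clear; lia.
(* The complete graph on [M] vertices does not have enough edges. *)
have small V : #|V| = M ->
    ~ ext2 (t - 1) #|V| + 2 * (t %/ 2) * (n - #|V|) <= esum V.
  move=> VM; have := leq_esum V; rewrite VM => VE /leq_trans/(_ VE) {VE}.
  (* Here Q = M - t. The complete graph on [M] vertices exceeds [ext2] by at most Q^2 / 2, and [hn]
     makes 2 (t %/ 2) (n - M) larger than that. *)
  have [Q QE] : exists Q, 8 * t * l + 4 * l + 3 * t = Q + 6.
    by exists (8 * t * l + 4 * l + 3 * t - 6); move: t2 l2; clear; lia.
  have h0 : 0 < 4 * (t %/ 2) by rewrite muln_gt0 divn_gt0.
  have := ltn_ceil (Q ^ 2) h0; move: hn; rewrite QE addnK.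
  set k := _ %/ _ => hn Qk.
  have kn : k.+1 <= n - M by move: hn ME t2 l2; clear; lia.
  have {Qk kn} : Q * Q < 4 * ((t %/ 2) * (n - M)).
    rewrite mulnn; apply: leq_trans Qk _.
    by rewrite mulnC -mulnA !leq_mul2l kn !orbT.
  rewrite /ext2 -[_ * _ * (n - M)]mulnA; move: (_ * (n - M)) => u.
  have -> : M - (t - 1) = Q.+1 by move: QE ME t2 l2; clear; lia.
  have -> : M = Q.+1 + (t - 1) by move: QE ME t2 l2; clear; lia.
  have := half_uphalf_sqr Q.+1.
  move: (_./2 * _) (odd _ : nat) (leq_b1 (odd Q.+1)) => w b b1.
  by case: (t - 1) => [|r]; rewrite ?addSn /=; move: b1; clear; lia.
have nM : M < n by move: hn ME; set k := _ %/ (4 * _); clear; lia.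
have step V x : M < #|V| -> #|V| <= n ->
    ext2 (t - 1) #|V| + 2 * (t %/ 2) * (n - #|V|) <= esum V ->
    x \in V -> 2 * #|nbr x :&: V| < #|V| ->
    ext2 (t - 1) #|V :\ x| + 2 * (t %/ 2) * (n - #|V :\ x|) <= esum (V :\ x).
  move=> MV Vn VE xV dx; have V1 : #|V| = #|V :\ x|.+1 by rewrite (cardsD1 x V) xV.
  move: VE; rewrite (esum_setD1 xV); move: MV Vn dx; rewrite V1.
  move: #|V :\ x| (#|nbr x :&: V|) (esum _) => m d E.
  move=> MV Vn dm; rewrite ext2S; last by move: ME MV t2 l2; clear; nia.
  have -> : n - m = (n - m.+1).+1 by move: Vn; clear; lia.
  rewrite mulnS -/(ext2 _ _); have : (t %/ 2) + d <= (m + (t - 1).+1)./2.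
    by rewrite -divn2; move: dm t2; clear; lia.
  by move: (ext2 _ _) (_ * (n - _)) => e u; clear; lia.
(* Induction on the excess [k] over M + 1; at k = 0 one more deletion would contradict [small]. *)
suff clean k V : #|V| = M.+1 + k -> #|V| <= n ->
    ext2 (t - 1) #|V| + 2 * (t %/ 2) * (n - #|V|) <= esum V ->
    exists W : {set G}, [/\ 8 * t * l + 4 * t + 4 * l <= #|W| + 5,
    {in W, forall x, #|W| <= 2 * #|nbr x :&: W|}
    & ext2 (t - 1) #|W| + 2 * (t %/ 2) * (n - #|W|) <= esum W].
  apply: (clean (n - M.+1) [set: G]); rewrite cardsT Gn //.
    by move: nM; clear; lia.
  by rewrite subnn muln0 addn0.
elim: k V => [|k IHk] V Vk Vn VE;
  (have [x /andP[xV dx]|noV] :=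
    pickP (fun x => (x \in V) && (2 * #|nbr x :&: V| < #|V|));
  last by exists V; split=> // [|x xV]; [move: Vk ME; clear; lia
    | have := noV x; rewrite xV /= ltnNge => /negbFE]);
  (have V1 : #|V| = #|V :\ x|.+1 by rewrite (cardsD1 x V) xV);
  (have VxE := step V x _ Vn VE xV dx).
- case: (small (V :\ x)); last by apply: VxE; move: Vk; clear; lia.
  by move: Vk V1; clear; lia.
- apply: (IHk (V :\ x)); last by apply: VxE; move: Vk; clear; lia.
    by move: Vk V1; clear; lia.
  by move: Vn V1; clear; lia.
Qed.

End EdgeSums.

(** * Structure of the dense subset *)

(** A bound without halves; it is attained when m - r is odd. *)
Lemma ext2_ge r m : r <= m -> m * m + 2 * r * m <= 2 * ext2 r m + r.+1 * r.+1.
Proof.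
move=> rm; rewrite /ext2; have -> : m = (m - r) + r by rewrite subnK.
rewrite addnK; move: (m - r) => p; have := half_uphalf_sqr p.
move: (_./2 * _) (odd _ : nat) (leq_b1 (odd p)) => w b b1.
by case: r {rm} => [|r] /=; move: b1; clear; lia.
Qed.

Definition bip_pair (G : sgraph) (X Y : {set G}) :=
  [/\ [disjoint X & Y], {in X &, forall x y, ~~ adj x y}
    & {in Y &, forall x y, ~~ adj x y}].

Section Structure.
Variables (G : sgraph) (t l : nat).
Hypotheses (t2 : 2 <= t) (l2 : 2 <= l).
Hypothesis free : forall F : seq (seq G),
  size F = t -> all (is_cycle (2 * l + 1)) F -> ~~ uniq (flatten F).
Implicit Types (A V X Y : {set G}).

(** A maximal packing has at most t - 1 cycles, so at most s = (t - 1)(2l + 1) vertices are removed.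
    The degree condition of [bipartition] then follows from |V| >= 4s + 12l - 4 = 8tl + 4t + 4l -
    8. *)
Lemma core_bipartite V :
    8 * t * l + 4 * t + 4 * l <= #|V| + 5 ->
    {in V, forall x, #|V| <= 2 * #|nbr x :&: V|} ->
  exists X Y, [/\ X :|: Y \subset V, bip_pair X Y
                & #|V| <= #|X :|: Y| + (t - 1) * (2 * l + 1)].
Proof.
move=> Vbig Vdeg.
have sizeP c : is_cycle (2 * l + 1) c && all (mem V) c -> size c = 2 * l + 1 /\ uniq c.
  by case/andP=> /and3P[/eqP].
have [[F [Fs FP Fu]]|[F [Fs FP Fu Fmax]]] := packing_or_maximal t sizeP.
  have := free Fs; rewrite Fu => /(_ _)/negP[] //.
  by apply: sub_all FP => c /andP[].
set S := [set x in flatten F]; have AV : V :\: S \subset V by apply: subsetDl.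
have Sq : #|V| <= #|V :\: S| + (t - 1) * (2 * l + 1).
  have S_le : #|S| <= size F * (2 * l + 1).
    rewrite cardsE (card_uniqP Fu).
    elim: (F) FP => //= c E IHE /andP[/andP[/and3P[/eqP cs _ _] _] /IHE].
    by rewrite size_cat cs mulSn leq_add2l.
  have F1 : size F <= t - 1 by move: Fs; clear; lia.
  have := leq_mul F1 (leqnn (2 * l + 1)); move: S_le.
  rewrite cardsD; have := subset_leq_card (subsetIr V S); clear; lia.
have [||X [Y [XY dXY iX iY]]] := @bipartition G (V :\: S) l l2; last first.
- by exists X, Y; rewrite XY; split.
- move=> c cC; apply/negP=> cA; have /Fmax : is_cycle (2 * l + 1) c && all (mem V) c.
    rewrite cC; apply/allP=> x /(allP cA); exact: (subsetP AV).
  by case/hasP=> x xF /(allP cA); rewrite !inE xF.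
- move=> x /setDP[xV _]; have := Vdeg x xV; have := subset_leq_card AV.
  have : #|nbr x :&: V| <= #|nbr x :&: (V :\: S)| + #|V :\: (V :\: S)|.
    rewrite -cardsUI; apply: leq_trans (leq_addr _ _); apply/subset_leq_card.
    by apply/subsetP=> y; rewrite !inE => /andP[-> ->]; case: (y \in flatten F).
  rewrite [#|V :\: (V :\: S)|]cardsD (setIidPr AV).
  move: Sq Vbig; move: #|V| #|V :\: S| #|nbr x :&: V| (#|nbr x :&: _|) => m a d e.
  have : (t - 1) * (2 * l + 1) + (2 * l + 1) = t * (2 * l + 1).
    by rewrite -mulSnr -subSn; [congr (_ * _)|]; move: t2; clear; lia.
  move: (_ * (2 * l + 1)) => q; rewrite mulnDr mulnCA mulnA muln1.
  clear; lia.
Qed.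

(** A core vertex has degree at most q plus the size of the other side, a removed one at most |V|;
    then 4 |X| |Y| is bounded by the square of |X| + |Y|. *)
Lemma esum_core V X Y (q : nat) :
    X :|: Y \subset V -> bip_pair X Y -> #|V| = #|X :|: Y| + q ->
  2 * esum V <= #|V| * #|V| + 2 * q * #|V|.
Proof.
move=> AV [dXY iX iY] Vq; set A := X :|: Y in AV Vq.
have VDA : #|V :\: A| = q by rewrite cardsD (setIidPr AV) Vq addKn.
have XYc : #|A| = #|X| + #|Y| by rewrite cardsU disjoint_setI0 // cards0 subn0.
rewrite /esum (big_setID A) /= (setIidPr AV).
have S1 : \sum_(x in V :\: A) #|nbr x :&: V| <= q * #|V|.
  rewrite -VDA -sum_nat_const; apply: leq_sum => x _.
  exact/subset_leq_card/subsetIr.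
have dA (B C : {set G}) x : x \in B -> {in B &, forall x y, ~~ adj x y} ->
    B :|: C = A -> #|nbr x :&: V| <= #|C| + q.
  move=> xB iB BC; rewrite -VDA -cardsUI; apply: leq_trans (leq_addr _ _).
  apply/subset_leq_card/subsetP=> y; rewrite -BC !inE => /andP[xy ->].
  by have := contraL (iB x y xB) xy; case: (y \in B) => [->|] //=; case: (y \in C).
have S2 : \sum_(x in A) #|nbr x :&: V| <= #|X| * (#|Y| + q) + #|Y| * (#|X| + q).
  rewrite (eq_bigl [predU X & Y]) => [|x]; last by rewrite !inE.
  rewrite bigU //= -!sum_nat_const.
  by apply: leq_add; apply: leq_sum => x xB; apply: dA xB _ _; rewrite // setUC.
move: S1 S2 Vq; rewrite XYc; move: #|X| #|Y| #|V| (\sum_(_ in A) _) (\sum_(_ in _) _).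
move=> x y m s1 s2 H1 H2 mE; rewrite mE in H1 *.
by move: (nat_AGM2 x y).1 H1 H2; rewrite -mulnn; clear; lia.
Qed.

(** Comparing the surplus with [esum_core] bounds n by about (2l + 1) |V|. For a smaller [V] this is
    24tl^2 to leading order, while [hn] makes n at least about 32tl^2. *)
Lemma core_large V X Y (n : nat) :
    (8 * t * l + 4 * l + 3 * t - 6) ^ 2 %/ (4 * (t %/ 2))
      + 8 * t * l + 4 * t + 4 * l - 5 <= n -> t <= #|V| ->
    ext2 (t - 1) #|V| + 2 * (t %/ 2) * (n - #|V|) <= esum V ->
    X :|: Y \subset V -> bip_pair X Y ->
    #|V| <= #|X :|: Y| + (t - 1) * (2 * l + 1) ->
  12 * t * l + 14 * t <= #|V|.
Proof.
move=> hn tV VE AV bXY Vq.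
have Vc : #|V| = #|X :|: Y| + (#|V| - #|X :|: Y|).
  by rewrite subnKC // subset_leq_card.
have := esum_core AV bXY Vc; have {Vq Vc} := Vq; rewrite -leq_subLR.
move: (_ - #|X :|: Y|) => q qle VE2; rewrite leqNgt; apply/negP=> small.
have [Q QE] : exists Q, 8 * t * l + 4 * l + 3 * t = Q + 6.
  by exists (8 * t * l + 4 * l + 3 * t - 6); move: t2 l2; clear; lia.
have h0 : 0 < 4 * (t %/ 2) by rewrite muln_gt0 divn_gt0.
have := ltn_ceil (Q ^ 2) h0; move: hn; rewrite QE addnK.
set k := _ %/ _; move: k => k hn Qk; have := ext2_ge (leq_trans (leq_subr 1 t) tV).
have : t - 1 <= 2 * (t %/ 2) <= t by clear; lia.
move: VE VE2 tV small qle Qk; rewrite -mulnn.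
move: #|V| (ext2 _ _) (esum _) (t %/ 2) => m e s h.
move=> VE VE2 tm small qle Qk /andP[h1 h2] eE.
have [r tE] : exists r, t = r.+2 by exists (t - 2); move: t2; clear; lia.
have [a lE] : exists a, l = a.+2 by exists (l - 2); move: l2; clear; lia.
(* Division by t - 1, using 2 (t %/ 2) >= t - 1, q <= (t - 1)(2l + 1) and t^2 / (t - 1) <= t + 2. *)
have nm : 2 * (n - m) <= 4 * l * m + t + 2.
  have rt : t - 1 = r.+1 by move: tE; clear; lia.
  have E1 : 2 * (r.+1 * (n - m)) <= 2 * (2 * h * (n - m)).
    by rewrite leq_mul2l /= leq_mul2r -rt h1 orbT.
  have E2 : 2 * q * m <= 2 * (r.+1 * (2 * l + 1)) * m.
    by rewrite leq_mul2r leq_mul2l -rt qle !orbT.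
  rewrite -(leq_pmul2l (ltn0Sn r)).
  move: VE VE2 eE E1 E2; rewrite rt tE.
  move: (2 * q * m) (2 * h * (n - m)) => v u; move: (n - m) => w.
  clear; lia.
have Qt : Q * Q < k.+1 * (2 * t).
  by apply: leq_trans Qk _; rewrite leq_mul2l; move: h2; clear; lia.
have k2 : 2 * k.+1 <= (4 * l + 2) * m + t + 14 - 16 * t * l - 8 * t - 8 * l.
  by move: hn nm tm; clear; lia.
have {}k2 : 2 * k.+1 + 16 * t * l + 8 * t + 8 * l
              <= (4 * l + 2) * (12 * t * l + 14 * t) + t + 14.
  have := leq_mul (leqnn (4 * l + 2)) (ltnW small); move: k2 hn nm tm.
  by clear; lia.
have {Qt} : Q * Q < t * (2 * k.+1) by move: Qt; clear; lia.
have {}QE : Q = 8 * (r * a) + 19 * r + 20 * a + 40.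
  by move: QE; rewrite tE lE; clear; lia.
have K2 : 2 * k.+1
    <= (4 * l + 2) * (12 * t * l + 14 * t) + t + 14 - 16 * t * l - 8 * t - 8 * l.
  by move: k2; clear; lia.
apply/negP; rewrite -leqNgt; apply: leq_trans (leq_mul (leqnn t) K2) _.
rewrite QE tE lE; clear; nia.
Qed.
End Structure.

(** * Degrees, codegrees and inner edges relative to a bipartition *)

Section Degrees.
Variable G : sgraph.
Implicit Types (K V W X Y Z : {set G}).

Lemma leq_deg_side V X Y x :
    X :|: Y \subset V -> {in X &, forall x y, ~~ adj x y} -> x \in X ->
  #|nbr x :&: V| + #|X :|: Y| <= #|nbr x :&: Y| + #|V|.
Proof.
move=> AV iX xX; have := cardsUI (nbr x :&: V) (X :|: Y).
have -> : nbr x :&: V :&: (X :|: Y) = nbr x :&: Y.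
  apply/setP=> y; rewrite !inE; case xy: (adj x y) => //=.
  case yX: (y \in X) => /=; first by have := iX x y xX yX; rewrite xy.
  by case yY: (y \in Y); rewrite ?andbF // (subsetP AV) // inE yY orbT.
have : #|nbr x :&: V :|: (X :|: Y)| <= #|V|.
  by apply/subset_leq_card; rewrite subUset subsetIr.
clear; lia.
Qed.

(** With m = |V|, both [u] and [v] have at least m/2 - q neighbours in [X], and |X| <= m/2 because a
    vertex of [X] has its core neighbours in [Y]. Such a vertex exists by 2q < m. *)
Lemma codeg_core V X Y (q : nat) :
    {in V, forall x, #|V| <= 2 * #|nbr x :&: V|} ->
    X :|: Y \subset V -> bip_pair X Y -> #|V| <= #|X :|: Y| + q -> 2 * q < #|V| ->
  {in Y &, forall u v, #|V| <= 2 * codeg (X :|: Y) u v + 4 * q}.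
Proof.
move=> Vdeg AV [dXY iX iY] Vq q2 u v uY vY.
have YXV : Y :|: X \subset V by rewrite setUC.
have du := leq_deg_side YXV iY uY; have dv := leq_deg_side YXV iY vY.
have Vu : u \in V by apply: (subsetP AV); rewrite inE uY orbT.
have Vv : v \in V by apply: (subsetP AV); rewrite inE vY orbT.
have /card_gt0P[x /setIP[_ xX]] : 0 < #|nbr u :&: X|.
  by move: du (Vdeg u Vu) Vq q2; rewrite setUC; clear; lia.
have Vx : x \in V by apply: (subsetP AV); rewrite inE xX.
have dx := leq_deg_side AV iX xX; have xY := subset_leq_card (subsetIr (nbr x) Y).
have := cardsUI (nbr u :&: X) (nbr v :&: X); rewrite -setIIl -setIUl.
have := subset_leq_card (subsetIr (nbr u :|: nbr v) X).
have : #|nbr u :&: nbr v :&: X| <= codeg (X :|: Y) u v.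
  by apply/subset_leq_card/setIS/subsetUl.
have : #|X :|: Y| = #|X| + #|Y| by rewrite cardsU disjoint_setI0 // cards0 subn0.
move: du dv dx xY (Vdeg u Vu) (Vdeg v Vv) (Vdeg x Vx) Vq q2; rewrite (setUC Y).
clear; lia.
Qed.

(* [Z] is one side of a bipartition of [V]; the inner edges are those that do
   not cross it. *)
Definition inner V Z : rel G :=
  [rel x y | [&& adj x y, x \in V, y \in V & (x \in Z) == (y \in Z)]].

Lemma inner_sym V Z : symmetric (inner V Z).
Proof.
by move=> x y; rewrite /inner /= adj_sym eq_sym; case: (x \in V); rewrite ?andbF.
Qed.

Lemma inner_irr V Z : irreflexive (inner V Z).
Proof. by move=> x; rewrite /inner /= adj_irr. Qed.

(** A vertex outside [K] has its neighbours in [K], on the opposite side, or along inner edges. *)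
Lemma leq_esum_inner V K Z : K \subset V ->
  esum V <= #|K| * #|V|.-1 + #|K| * #|V :\: K|
    + 2 * (#|(V :\: K) :&: Z| * #|(V :\: K) :\: Z|)
    + \sum_(x in V :\: K) #|[set y in V :\: K | inner V Z x y]|.
Proof.
move=> KV; rewrite /esum (big_setID K) /= (setIidPr KV) -!addnA.
apply: leq_add.
  rewrite -sum_nat_const; apply: leq_sum => x /(subsetP KV) xV.
  rewrite (cardsD1 x V) xV /=; apply/subset_leq_card/subsetP=> y.
  by rewrite !inE => /andP[/adj_neq xy ->]; rewrite eq_sym xy.
set W := V :\: K.
apply: (@leq_trans (\sum_(x in W) (#|K| + (if x \in Z then #|W :\: Z| else #|W :&: Z|)
    + #|[set y in W | inner V Z x y]|))).
  apply: leq_sum => x /setDP[xV xK].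
  have sub : nbr x :&: V \subset
      K :|: (if x \in Z then W :\: Z else W :&: Z) :|: [set y in W | inner V Z x y].
    apply/subsetP=> y /setIP[]; rewrite in_nbr => xy yV.
    rewrite in_setU in_setU [y \in [set _ in _ | _]]inE /inner /= xy xV yV.
    by case: (x \in Z); case yZ: (y \in Z); rewrite !inE yV yZ; case: (y \in K).
  apply: leq_trans (subset_leq_card sub) _.
  rewrite cardsU.
  apply: leq_trans (leq_subr _ _) _; rewrite leq_add2r cardsU.
  by apply: leq_trans (leq_subr _ _) _; case: (x \in Z).
rewrite !big_split /= -addnA; apply: leq_add; first by rewrite sum_nat_const mulnC.
rewrite add0n addnA leq_add2r (big_setID Z) /=; apply: leq_add.
  by rewrite -sum_nat_const; apply: leq_sum => x /setIP[_ ->].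
by rewrite mulnC -sum_nat_const; apply: leq_sum => x /setDP[_ /negPf->].
Qed.

End Degrees.

(** * Covering the inner edges by t - 1 vertices *)

Section AlmostBipartite.
Variables (G : sgraph) (t l : nat).
Hypotheses (t2 : 2 <= t) (l2 : 2 <= l).
Hypothesis free : forall F : seq (seq G),
  size F = t -> all (is_cycle (2 * l + 1)) F -> ~~ uniq (flatten F).
Implicit Types (K V W X Y Z : {set G}) (M : seq (seq G)).

Lemma matching_size I V M : matching I V M -> size (flatten M) = 2 * size M.
Proof.
case/andP=> + _; elim: M => //= e M IHM /andP[/and4P[/eqP es _ _ _] /IHM].
by rewrite size_cat es => ->; clear; lia.
Qed.

(** Otherwise each inner edge closes to a cycle through the core side opposite to its ends. The
    threshold 2tl + 3t counts the 2t matched vertices and t cycles of length 2l + 1. *)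
Lemma inner_matching_neq V W X Y Z M :
    {in V, forall x, 2 * t * l + 3 * t <= #|nbr x :&: (if x \in Z then Y else X)|} ->
    {in X &, forall x y, 2 * t * l + 3 * t <= codeg (X :|: Y) x y} ->
    {in Y &, forall x y, 2 * t * l + 3 * t <= codeg (X :|: Y) x y} ->
    matching (inner V Z) W M -> size M <> t.
Proof.
move=> deg DX DY MI Mt.
have [|||F [Fs FC Fu _]] := @matching_packing G (X :|: Y) (inner V Z) W
    (2 * t * l + 3 * t) l M [set x in flatten M] _ MI.
- move=> x y U /and4P[xy xV yV /eqP xyZ] xU yU UD.
  have := deg x xV; have := deg y yV; rewrite -xyZ.
  case: (x \in Z) => dy dx.
    exact: (cycle_through_edge l2 (subsetUr X Y) DY xy xU yU UD dx dy).
  exact: (cycle_through_edge l2 (subsetUl X Y) DX xy xU yU UD dx dy).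
- by move=> x xM; rewrite inE.
- rewrite cardsE; apply: leq_trans (leq_add (card_size _) (leqnn _)) _.
  by rewrite (matching_size MI) Mt; clear; lia.
by have := free (etrans Fs Mt) FC; rewrite Fu.
Qed.

(** Every inner edge in [W] meets one of at most 2 size M matched vertices, each of inner degree
    below 2t; the sum counts each edge twice. *)
Lemma leq_sum_inner V Z W M :
    W \subset V -> {in W, forall x, #|[set y in V | inner V Z x y]| < 2 * t} ->
    matching (inner V Z) W M ->
    {in W &, forall x y, inner V Z x y -> (x \in flatten M) || (y \in flatten M)} ->
  \sum_(x in W) #|[set y in W | inner V Z x y]| <= 8 * size M * t.
Proof.
move=> WV degW MI Mmax; set T := [set x in flatten M].
have TW : #|T :&: W| <= 2 * size M.
  apply: leq_trans (subset_leq_card (subsetIl _ _)) _.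
  by rewrite cardsE -(matching_size MI); apply: card_size.
have degT x : x \in W -> #|[set y in W | inner V Z x y]|
    <= (if x \in T then 2 * t else 0) + \sum_(z in T :&: W) inner V Z z x.
  move=> xW; have degWV : #|[set y in W | inner V Z x y]| < 2 * t.
    apply: leq_ltn_trans (degW x xW); apply/subset_leq_card/subsetP=> y.
    by rewrite !inE => /andP[/(subsetP WV)-> ->].
  case: ifP => xT; first by apply: leq_trans (leq_addr _ _); apply: ltnW.
  rewrite add0n -sum1_card big_mkcond [leqRHS]big_mkcond; apply: leq_sum => z _.
  case: ifP => //; rewrite inE => /andP[zW xz].
  have := Mmax x z xW zW xz; rewrite inE in xT; rewrite xT /= => zM.
  by rewrite inE zW inE zM inner_sym xz.
apply: (@leq_trans (\sum_(x in W) ((if x \in T then 2 * t else 0)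
    + \sum_(z in T :&: W) inner V Z z x))); first exact: leq_sum.
rewrite big_split /= exchange_big /=.
have -> : 8 * size M * t = 2 * size M * (2 * t) + 2 * size M * (2 * t).
  by clear; lia.
apply: leq_add.
  rewrite -big_mkcondr /=; apply: (@leq_trans (\sum_(x in T :&: W) 2 * t)).
    rewrite leq_eqVlt; apply/orP; left.
    by apply/eqP/eq_bigl => x; rewrite in_setI andbC.
  by rewrite sum_nat_const leq_mul2r TW orbT.
apply: (@leq_trans (\sum_(x in T :&: W) 2 * t)); last first.
  by rewrite sum_nat_const leq_mul2r TW orbT.
apply: leq_sum => z /setIP[_ zW]; apply: leq_trans (ltnW (degW z zW)).
rewrite -sum1_card big_mkcond [leqRHS]big_mkcond; apply: leq_sum => x _.
case: ifP => // /(subsetP WV) xV; rewrite inE xV andTb.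
by case: (inner V Z z x).
Qed.

Lemma almost_bipartite V (n : nat) :
    (8 * t * l + 4 * l + 3 * t - 6) ^ 2 %/ (4 * (t %/ 2))
      + 8 * t * l + 4 * t + 4 * l - 5 <= n ->
    8 * t * l + 4 * t + 4 * l <= #|V| + 5 ->
    {in V, forall x, #|V| <= 2 * #|nbr x :&: V|} ->
    ext2 (t - 1) #|V| + 2 * (t %/ 2) * (n - #|V|) <= esum V ->
  exists K Z, [/\ K \subset V, #|K| = t - 1
                & {in V :\: K &, forall x y, ~~ inner V Z x y}].
Proof.
move=> hn Vbig Vdeg VE.
have [X [Y [AV bXY Vq]]] := core_bipartite t2 l2 free Vbig Vdeg.
have tV : t <= #|V| by move: Vbig t2 l2; clear; nia.
have mbig := core_large t2 l2 hn tV VE AV bXY Vq.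
set q := (t - 1) * (2 * l + 1) in Vq.
have qE : q + 2 * l + 1 = 2 * t * l + t.
  by rewrite /q; case: (t) t2 => // r _; rewrite subn1 /=; clear; lia.
have q2 : 2 * q < #|V| by move: mbig qE t2 l2; clearbody q; clear; nia.
have bYX : bip_pair Y X by case: bXY => d iX iY; split; rewrite // disjoint_sym.
have DY u v (uY : u \in Y) (vY : v \in Y) : 2 * t * l + 3 * t <= codeg (X :|: Y) u v.
  have := codeg_core Vdeg AV bXY Vq q2 uY vY.
  by move: mbig qE t2 l2; clearbody q; clear; nia.
have DX u v (uX : u \in X) (vX : v \in X) : 2 * t * l + 3 * t <= codeg (X :|: Y) u v.
  have AV' : Y :|: X \subset V by rewrite setUC.
  have Vq' : #|V| <= #|Y :|: X| + q by rewrite setUC.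
  have := codeg_core Vdeg AV' bYX Vq' q2 uX vX; rewrite setUC.
  by move: mbig qE t2 l2; clearbody q; clear; nia.
(* Each removed vertex goes to the side where it has fewer neighbours; [Z] is the side containing
   [X]. *)
pose Z := X :|: [set x in V :\: Y | #|nbr x :&: X| <= #|nbr x :&: Y|].
have [dXY iX iY] := bXY.
have deg x : x \in V -> 2 * t * l + 3 * t <= #|nbr x :&: (if x \in Z then Y else X)|.
  move=> xV; have dx := Vdeg x xV; rewrite !inE xV.
  case xX: (x \in X) => /=.
    have := leq_deg_side AV iX xX; move: dx Vq mbig qE t2 l2.
    by clearbody q; clear; nia.
  case xY: (x \in Y) => /=.
    have AV' : Y :|: X \subset V by rewrite setUC.
    have := leq_deg_side AV' iY xY; rewrite setUC; move: dx Vq mbig qE t2 l2.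
    by clearbody q; clear; nia.
  (* The larger of the two core degrees is at least (|V|/2 - q)/2, which exceeds 2tl + 3t because
     |V| >= 12tl + 14t and q < 2tl + t. *)
  have : #|nbr x :&: V| <= #|nbr x :&: X| + #|nbr x :&: Y| + #|V :\: (X :|: Y)|.
    have sub : nbr x :&: V \subset
        (nbr x :&: X) :|: (nbr x :&: Y) :|: (V :\: (X :|: Y)).
      apply/subsetP=> y; rewrite !inE => /andP[-> ->] /=.
      by case: (y \in X); case: (y \in Y).
    apply: leq_trans (subset_leq_card sub) _.
    rewrite cardsU; apply: leq_trans (leq_subr _ _) _; rewrite leq_add2r cardsU.
    exact: leq_subr.
  rewrite cardsD (setIidPr AV); move: dx Vq mbig qE t2 l2.
  by clearbody q; case: (leqP #|nbr x :&: X|); clear; lia.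
pose I := inner V Z; pose K := [set x in V | 2 * t <= #|[set y in V | I x y]|].
have KV : K \subset V by apply/subsetP=> x; rewrite inE => /andP[].
have sizeP s : [&& size s == 2, uniq s, all (mem (V :\: K)) s & cycle I s] ->
    size s = 2 /\ uniq s.
  by case/and4P=> /eqP.
have [[M [Ms MP Mu]]|[M [Ms MP Mu Mmax]]] := packing_or_maximal t sizeP.
  have MI : matching I (V :\: K) M by rewrite /matching MP.
  by case: (inner_matching_neq deg DX DY MI Ms).
have MI : matching I (V :\: K) M by rewrite /matching MP.
have MK x : x \in flatten M -> x \in V :\: K.
  case/flattenP=> s sM xs; have /and4P[_ _ /allP sVK _] := allP MP s sM.
  exact: sVK.
(* Otherwise vertices of [K], of inner degree at least 2t, would complete [M] to t disjoint inner
   edges. *)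
have jk : size M + #|K| < t.
  rewrite ltnNge; apply/negP=> jk.
  have ks : size (take (t - size M) (enum K)) = t - size M.
    rewrite size_take -cardE; move: jk; move: #|K| (size M) => a b.
    by clear; case: ltnP; lia.
  have MIV : matching I V M.
    rewrite /matching Mu andbT; apply: sub_all MP => s /and4P[-> -> /allP sVK ->].
    by rewrite andbT; apply/allP=> x /sVK/setDP[].
  have [||||M' M'I M's] := star_matching (s := take (t - size M) (enum K))
    (@inner_sym G V Z) (@inner_irr G V Z) _ _ _ MIV.
  - by rewrite take_uniq ?enum_uniq.
  - by apply/allP=> x /mem_take; rewrite mem_enum => /(subsetP KV).
  - apply/hasPn=> x /mem_take; rewrite mem_enum => xK.
    by apply/negP=> /MK; rewrite inE xK.
  - move=> x /mem_take; rewrite mem_enum inE => /andP[_].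
    by rewrite ks subnKC // ltnW.
  apply: (inner_matching_neq deg DX DY M'I); rewrite M's ks subnKC //; exact: ltnW.
have Mcov : {in V :\: K &, forall x y, I x y -> (x \in flatten M) || (y \in flatten M)}.
  move=> x y xW yW xy; have xNy : x != y by case/and4P: xy => /adj_neq.
  have /Mmax : [&& size [:: x; y] == 2, uniq [:: x; y],
      all (mem (V :\: K)) [:: x; y] & cycle I [:: x; y]].
    rewrite /= xW yW inE xNy /=; apply/and3P; split=> //.
    by have := inner_sym V Z x y; rewrite -/I /I => <-.
  by case/hasP=> z zM; rewrite !inE => /pred2P[] <-; rewrite zM ?orbT.
have Klow x : x \in V :\: K -> #|[set y in V | I x y]| < 2 * t.
  by rewrite !inE ltnNge => /andP[+ xV]; rewrite xV.
have Isum := leq_sum_inner (subsetDl V K) Klow MI Mcov.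
(* If [K] had d + 1 vertices too few, [esum] would lose about (d + 1) |V|, at least 38 (d + 1) t,
   whereas inner edges outside [K] bring back at most 8 (d + 1) t. *)
have KE : #|K| = t - 1 /\ size M = 0.
  have := leq_esum_inner Z KV; have := ext2_ge (leq_trans (leq_subr 1 t) tV).
  have Wc : #|V| = #|K| + #|V :\: K| by rewrite -(cardsID K V) (setIidPr KV).
  have := cardsID Z (V :\: K); move: Isum VE mbig jk t2 l2.
  move: (\sum_(_ in _) _) #|_ :&: Z| #|_ :\: Z| (ext2 _ _) (esum V) (_ * (n - _)) Wc.
  move: #|V| #|K| (#|V :\: K|) (size M).
  move=> m k s j i a b e E u mE iE VE mbig jk t2' l2' sE eE EE.
  have [kt|kt] := ltnP k (t - 1); last by move: jk kt; clear; lia.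
  have [d tE] : exists d, t = k + d.+2 by exists (t - k.+2); move: kt; clear; lia.
  have dm : d.+1 * (38 * t) <= d.+1 * m.
    by rewrite leq_mul2l /=; move: mbig l2'; clear; nia.
  have jt : j * t <= d.+1 * t by rewrite leq_mul2r; move: jk tE; clear; lia.
  have km : k * m.-1 <= k * m by rewrite leq_mul2l leq_pred orbT.
  have := (nat_AGM2 a b).1; rewrite sE -mulnn => ab.
  have rE : t - 1 = k + d.+1 by move: tE; clear; lia.
  move: eE VE EE iE dm jt km; rewrite rE tE mE; move: ab.
  by clear; lia.
exists K, Z; split=> //; first by case: KE.
move=> x y xW yW; apply/negP=> /(Mcov x y xW yW).
by rewrite (size0nil KE.2).
Qed.
End AlmostBipartite.

(** * Uniqueness *)

Lemma leq_mul_half a b : a * b <= (a + b)./2 * uphalf (a + b).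
Proof.
have := (nat_AGM2 a b).1; rewrite -mulnn -half_uphalf_sqr.
by move: (_./2 * _) (leq_b1 (odd (a + b))) => w; clear; lia.
Qed.

(** The square of a + b less 4ab is the square of b - a; equality makes it the parity of a + b, so b
    - a is 0 or 1. *)
Lemma eq_mul_half a b :
  a <= b -> a * b = (a + b)./2 * uphalf (a + b) -> a = (a + b)./2 /\ b = uphalf (a + b).
Proof.
move=> ab E; have := half_uphalf_sqr (a + b); rewrite -E.
have [d bE] : exists d, b = a + d by exists (b - a); rewrite subnKC.
rewrite bE => dE; have d1 : d * d <= 1.
  by move: dE (leq_b1 (odd (a + (a + d)))); clear; lia.
by case: d {E bE dE} d1 => [|[|d]] //; clear; split; lia.
Qed.

Lemma nbr_maximal (G : sgraph) (A : {set G}) x :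
  nbr x \subset A -> #|nbr x| = #|A| -> forall y, adj x y = (y \in A).
Proof.
move=> sub card y; have /eqP <- : nbr x == A by rewrite eqEcard sub card leqnn.
by rewrite in_nbr.
Qed.

(** Each neighbourhood lies in the set [B x] that the join on [K], [X], [Y] would give. The sizes of
    these sets sum to at most [ext2], so all inclusions are equalities, and |X| |Y| is maximal, so
    the sides are balanced. *)
Lemma bipartite_extremal (G : sgraph) (r : nat) (K Z : {set G}) :
    #|K| = r -> ext2 r #|G| <= esum [set: G] ->
    {in ~: K &, forall x y, ~~ inner [set: G] Z x y} ->
  giso G (join (complete_graph r) (turan2 (#|G| - r))).
Proof.
move=> Kr GE iKZ; set X := ~: K :&: Z; set Y := ~: K :\: Z.
have XYc : #|X| + #|Y| = #|G| - r by rewrite cardsID -Kr -(cardsC K) addKn.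
have Gr : r <= #|G| by rewrite -Kr max_card.
have iX : {in X &, forall x y, ~~ adj x y}.
  move=> x y /setIP[xK xZ] /setIP[yK yZ]; have := iKZ x y xK yK.
  by rewrite /inner /= !in_setT xZ yZ eqxx !andbT.
have iY : {in Y &, forall x y, ~~ adj x y}.
  move=> x y /setDP[xK /negPf xZ] /setDP[yK /negPf yZ]; have := iKZ x y xK yK.
  by rewrite /inner /= !in_setT xZ yZ eqxx !andbT.
have inX x : (x \in X) = (x \notin K) && (x \in Z) by rewrite !inE.
have inY x : (x \in Y) = (x \notin K) && (x \notin Z) by rewrite !inE andbC.
pose B x := if x \in K then [set~ x] else if x \in Z then K :|: Y else K :|: X.
have subB x : nbr x \subset B x.
  apply/subsetP=> y; rewrite in_nbr => xy; rewrite /B.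
  case xK: (x \in K); first by rewrite !inE eq_sym adj_neq.
  case xZ: (x \in Z); rewrite in_setU ?inX ?inY; case yK: (y \in K) => //=.
    case yZ: (y \in Z) => //; have := iX x y.
    by rewrite !inX xK xZ yK yZ xy => /(_ isT isT).
  case yZ: (y \in Z) => //; have := iY x y.
  by rewrite !inY xK xZ yK yZ xy => /(_ isT isT).
have KX : #|K :|: X| = r + #|X|.
  by rewrite cardsU Kr setIA setICr set0I cards0 subn0.
have KY : #|K :|: Y| = r + #|Y|.
  by rewrite cardsU Kr setIDA setICr set0D cards0 subn0.
have sumB : \sum_(x : G) #|B x| = r * #|G|.-1 + #|X| * (r + #|Y|) + #|Y| * (r + #|X|).
  rewrite (bigID (mem K)) /= -[in RHS]Kr -addnA; congr (_ + _).
    rewrite -sum_nat_const; apply: eq_bigr => x xK.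
    by rewrite /B xK cardsC1.
  rewrite (eq_bigl [in ~: K]) => [|x]; last by rewrite inE.
  rewrite (big_setID Z) /= -/X -/Y Kr -!sum_nat_const; congr (_ + _);
    apply: eq_bigr => x.
    by rewrite inX /B => /andP[/negPf-> ->].
  by rewrite inY /B => /andP[/negPf-> /negPf->].
have GE' : esum [set: G] = \sum_(x : G) #|nbr x|.
  by apply: eq_big => x; [rewrite inE | rewrite setIT].
have := leqif_sum (fun (x : G) (_ : true) => subset_leqif_cards (subB x)).
rewrite sumB -GE' => -[sumle sumeq].
have XY2 : #|X| * #|Y| = (#|G| - r)./2 * uphalf (#|G| - r).
  apply/eqP; rewrite eqn_leq -{1 2}XYc leq_mul_half /=.
  have : ext2 r #|G| <= r * #|G|.-1 + #|X| * (r + #|Y|) + #|Y| * (r + #|X|).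
    exact: leq_trans GE sumle.
  rewrite /ext2; have -> : #|G| = r + (#|X| + #|Y|) by rewrite XYc subnKC.
  rewrite addKn; move: (_./2 * _) => w; move: #|X| #|Y| => x y; clear.
  by case: r => [|r]; rewrite ?addSn /=; lia.
have Bmax x y : adj x y = (y \in B x).
  apply: nbr_maximal; first exact: subB.
  have : [forall x, nbr x == B x]; last by move=> /forallP/(_ x)/eqP->.
  rewrite -[X in is_true X]sumeq eqn_leq sumle /=; apply: leq_trans GE.
  rewrite /ext2 -XY2 -XYc mulnDr; clear -XYc Gr.
  have -> : #|G| = r + (#|X| + #|Y|) by rewrite XYc subnKC.
  move: #|X| #|Y| => x1 y1; clear.
  by case: r => [|r]; rewrite ?addSn /=; lia.
have adjK : {in K, forall x y, adj x y = (x != y)}.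
  by move=> x xK y; rewrite Bmax /B xK !inE eq_sym.
have adjXY : {in X & Y, forall x y, adj x y}.
  move=> x y; rewrite inX => /andP[/negPf xK xZ] yY.
  by rewrite Bmax /B xK xZ in_setU yY orbT.
have cov : K :|: X :|: Y = setT.
  by apply/setP=> x; rewrite !in_setU inX inY in_setT; case: (x \in K); case: (x \in Z).
have cardKXY : #|K| + #|X| + #|Y| = #|G| by rewrite -addnA XYc Kr subnKC.
rewrite /turan2; case: (leqP #|X| #|Y|) => [XY|/ltnW YX].
  have [|Xh Yh] := @eq_mul_half #|X| #|Y| XY; first by rewrite XYc.
  by rewrite -XYc -Xh -Yh -[r in complete_graph r]Kr; apply: join_bipartite_giso.
have [|Yh Xh] := @eq_mul_half #|Y| #|X| YX; first by rewrite addnC XYc mulnC.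
rewrite -XYc addnC -Xh -Yh -[r in complete_graph r]Kr.
apply: join_bipartite_giso => //.
- by rewrite setUAC.
- by rewrite addnAC.
- by move=> x y xY yX; rewrite adj_sym adjXY.
Qed.

Lemma esum_edges (G : sgraph) : esum [set: G] = 2 * #|edges G|.
Proof. by rewrite handshake; apply: eq_big => x; rewrite ?inE ?setIT. Qed.

Lemma dense_free_giso (G : sgraph) (t l n : nat) :
    2 <= t -> 2 <= l ->
    (8 * t * l + 4 * l + 3 * t - 6) ^ 2 %/ (4 * (t %/ 2))
      + 8 * t * l + 4 * t + 4 * l - 5 <= n ->
    #|G| = n -> gfree (copies t (cycle_graph (2 * l + 1))) G ->
    ext2 (t - 1) n <= 2 * #|edges G| ->
  giso G (join (complete_graph (t - 1)) (turan2 (n - t + 1))).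
Proof.
move=> t2 l2 hn Gn Gfree; rewrite -esum_edges => GE.
have tn : t <= n.
  apply: leq_trans hn; move: (_ %/ (4 * _)) => k; move: t2 l2; clear; nia.
have [x0 _] : exists x0 : G, x0 \in G.
  by apply/card_gt0P; rewrite Gn; apply: leq_trans tn; apply: ltnW.
have free (F : seq (seq G)) :
    size F = t -> all (is_cycle (2 * l + 1)) F -> ~~ uniq (flatten F).
  move=> Ft FC; apply: contra Gfree => Fu.
  exact: (packing_contains x0 Ft FC Fu).
have [V [Vbig Vdeg VE]] := dense_subset t2 l2 hn Gn GE.
have [K [Z [KV Kt iKZ]]] := almost_bipartite t2 l2 free hn Vbig Vdeg VE.
(* Without inner edges outside [K], [esum V] is at most [ext2 (t - 1) #|V|]; as t %/ 2 is positive,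
   a surplus term with |V| < n is impossible. *)
have Vn : #|V| = n.
  have := leq_esum_inner Z KV; rewrite [X in _ + X]big1 => [|x xW]; last first.
    apply/eqP; rewrite cards_eq0; apply/eqP/setP=> y; rewrite in_set0 inE.
    by case yW: (y \in V :\: K) => //=; apply/negbTE/iKZ.
  have Vle : #|V| <= n by rewrite -Gn max_card.
  have := leq_mul_half #|(V :\: K) :&: Z| #|(V :\: K) :\: Z|; rewrite cardsID.
  have Wc : #|V :\: K| = #|V| - (t - 1) by rewrite cardsD (setIidPr KV) Kt.
  have h1 : 0 < t %/ 2 by rewrite divn_gt0.
  have tV : t <= #|V| by move: Vbig t2 l2; clear; nia.
  have h2 : n - #|V| <= t %/ 2 * (n - #|V|) by rewrite leq_pmull.
  have m1 : #|V|.-1 = #|V| - (t - 1) + (t - 1).-1 by move: tV t2; clear; lia.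
  move: VE; rewrite Wc Kt m1 /ext2 mulnDr -(mulnA 2 (t %/ 2)) -(mulnA 2 (t - 1)).
  move: (#|_| * #|_|) (_./2 * _) ((t - 1) * (#|V| - _)) ((t - 1) * _.-1) h2 Vle.
  move: (t %/ 2 * _) => u a w b c; clear; lia.
have VT : V = [set: G] by apply/eqP; rewrite eqEcard subsetT cardsT Gn Vn leqnn.
have -> : n - t + 1 = #|G| - (t - 1) by rewrite Gn; move: tn t2; clear; lia.
rewrite -Gn in GE; apply: (bipartite_extremal Kt GE (Z := Z)) => x y xK yK.
by rewrite -VT; apply: iKZ; rewrite VT setTD.
Qed.

Theorem theorem1p1 (t l n : nat) (ht : 2 <= t) (hl : 2 <= l)
  (hn : (8 * t * l + 4 * l + 3 * t - 6) ^ 2 %/ (4 * (t %/ 2))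
        + 8 * t * l + 4 * t + 4 * l - 5 <= n) :
  extremal n (copies t (cycle_graph (2 * l + 1)))
    (join (complete_graph (t - 1)) (turan2 (n - t + 1)))
  /\ forall G : sgraph,
       extremal n (copies t (cycle_graph (2 * l + 1))) G ->
       giso G (join (complete_graph (t - 1)) (turan2 (n - t + 1))).
Proof.
set F := copies _ _; set H := join _ _.
have tn : t <= n.
  apply: leq_trans hn; move: (_ %/ (4 * _)) => k; move: ht hl; clear; nia.
have halves p : p./2 + uphalf p = p.
  by rewrite uphalf_half addnCA addnn odd_double_half.
have Hn : #|H| = n.
  by rewrite !card_sum !card_ord halves; move: tn ht; clear; lia.
have HF : gfree F H by apply: join_bipartite_free; move: ht hl; clear; lia.
have HE : 2 * #|edges H| = ext2 (t - 1) n.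
  rewrite join_bipartite_edges halves /ext2.
  by have -> : n - t + 1 = n - (t - 1) by move: tn ht; clear; lia.
have ge_ext2 (G : sgraph) : #|G| = n -> gfree F G -> #|edges G| = ex n F ->
    giso G H.
  move=> Gn GF GE; apply: (dense_free_giso ht hl hn Gn GF).
  by rewrite -HE leq_mul2l GE leq_ex.
(* The maximum is attained, [H] showing that the family is nonempty. [ge_ext2] identifies a
   maximizer with [H], which makes [H] itself extremal. *)
have [E EF EE] : exists2 E : {set {set 'I_n}}, gfree F (edgeset_graph E)
    & #|edges (edgeset_graph E)| = ex n F.
  have [E HE'] := giso_edgeset_graph Hn.
  have EF : gfree F (edgeset_graph E).
    by apply: contra HF; apply: giso_contains; apply: giso_sym.
  have free_gt0 : 0 < #|[pred E : {set {set 'I_n}} | gfree F (edgeset_graph E)]|.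
    by apply/card_gt0P; exists E.
  have [E' E'F E'E] :=
    eq_bigmax_cond (fun E : {set {set 'I_n}} => #|edges (edgeset_graph E)|) free_gt0.
  by exists E' => //; rewrite -E'E; apply: eq_bigl.
split; last by move=> G []; apply: ge_ext2.
split=> //; rewrite -EE; apply/esym/giso_edges/ge_ext2 => //.
exact: card_ord.
Qed.
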